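(* Let $t$ be a positive integer and let $\mathcal{A}$ be an algorithm that, for every loopless multigraph $D^*$ on the vertex set of $K_{n,n}$ with $\Delta(D^* )\le t$, computes a realization of $D^*$ in $K_{n,n}$. Then there is an algorithm $\mathcal{B}$ which, given a loopless multigraph $D$ on the vertex set of $K_{n,n}$, outputs a sub-multigraph $D^*\subseteq D$ together with a realization of $D^*$ in $K_{n,n}$ such that $e(D^* )\ge \frac{2t}{3n}\, e(D_{\mathrm{opt}})$, where $D_{\mathrm{opt}}$ is a sub-multigraph of $D$ with the maximum number of edges among those realizable in $K_{n,n}$ (i.e., $\mathcal{B}$ is a $(3n/2t)$-approximation algorithm for \textsc{MaxEDP} on $K_{n,n}$). The running time of $\mathcal{B}$ is at most $\mathcal{O}(e(D)\cdot n)$ plus the running time of $\mathcal{A}$ on the instance $(K_{n,n},D^* )$ for some sub-multigraph $D^*$ of $D$.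
   Context: $K_{n,n}$ is the complete bipartite graph with two color classes of size $n$. A realization of a loopless multigraph $D$ in $K_{n,n}$ (on the same vertex set) is a collection of pairwise edge-disjoint paths $P(e)$ in $K_{n,n}$, one for each edge $e\in E(D)$ (counted with multiplicity), with $P(e)$ joining the end-vertices of $e$; $D$ is realizable if a realization exists. The \textsc{MaxEDP} problem asks, given $D$, for a sub-multigraph $D'\subseteq D$ with the maximum number of edges that is realizable in $K_{n,n}$. $e(\cdot)$ counts edges with multiplicity and $\Delta$ is the maximum degree counting multiplicities. *)

(* Defs.v *)
From mathcomp Require Import all_boot all_order all_algebra.

Set Implicit Arguments.
Unset Strict Implicit.
Unset Printing Implicit Defensive.

Definition vertex (n : nat) : finType := (bool * 'I_n)%type.

Definition Knn (n : nat) : rel (vertex n) := fun u v => u.1 != v.1.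

(* Edges are unordered: a pair and its reverse stand for the same edge (see
   [joins]), and repetitions in the list are parallel edges.  The number of
   edges e(D) is [size D]. *)
Definition mgraph (n : nat) := seq (vertex n * vertex n).

Definition joins n (e : vertex n * vertex n) (u v : vertex n) : bool :=
  (e == (u, v)) || (e == (v, u)).

Definition loopless n (D : mgraph n) : bool := all (fun e => e.1 != e.2) D.

Definition mult n (D : mgraph n) (u v : vertex n) : nat :=
  count (fun e => joins e u v) D.

Definition submgraph n (D' D : mgraph n) : Prop :=
  forall u v, mult D' u v <= mult D u v.

Definition deg n (D : mgraph n) (v : vertex n) : nat :=
  \sum_(e <- D) ((e.1 == v) + (e.2 == v)).

Definition maxdeg n (D : mgraph n) : nat := \max_(v : vertex n) deg D v.

(* A path is the list of its vertices, without repetition. *)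
Definition path_for n (e : vertex n * vertex n) (p : seq (vertex n)) : bool :=
  if p is x :: q then [&& path (@Knn n) x q, uniq p & joins e x (last x q)]
  else false.

Definition path_edges n (p : seq (vertex n)) : mgraph n := zip p (behead p).

Definition edge_disjoint n (p q : seq (vertex n)) : bool :=
  all (fun e => mult (path_edges q) e.1 e.2 == 0) (path_edges p).

(* The i-th path of [P] realizes the i-th edge of [D]. *)
Definition realization n (D : mgraph n) (P : seq (seq (vertex n))) : bool :=
  all2 (@path_for n) D P && pairwise (@edge_disjoint n) P.

Definition realizable n (D : mgraph n) : Prop := exists P, realization D P.

Definition max_realizable n (D Dopt : mgraph n) : Prop :=
  [/\ submgraph Dopt D, realizable Dopt &
      forall D', submgraph D' D -> realizable D' -> size D' <= size Dopt].

(* Algorithms are programs for a unit-cost random access machine: countably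
   many cells holding natural numbers, indirect addressing, addition and
   truncated subtraction.  There is no multiplication, since at unit cost on
   unbounded numbers it would not be a reasonable time measure. *)

Definition memory := nat -> nat.

Inductive expr : Type :=
| Cst of nat
| Get of expr
| Add of expr & expr
| Sub of expr & expr.

Fixpoint eval (m : memory) (e : expr) : nat :=
  match e with
  | Cst k => k
  | Get e1 => m (eval m e1)
  | Add e1 e2 => eval m e1 + eval m e2
  | Sub e1 e2 => eval m e1 - eval m e2
  end.

Fixpoint cost (e : expr) : nat :=
  match e with
  | Cst _ => 1
  | Get e1 => (cost e1).+1
  | Add e1 e2 | Sub e1 e2 => (cost e1 + cost e2).+1
  end.

(* Conditions count as true when nonzero.  [Call e p] runs the subroutine [p]
   with the base register advanced by the value [b] of [e]: address [i] of [p]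
   is address [b + i] of the caller, so nothing is copied, and [p] cannot reach
   the caller's cells below [b]. *)
Inductive prog : Type :=
| Skip
| Put of expr & expr
| Seq of prog & prog
| If of expr & prog & prog
| While of expr & prog
| Call of expr & prog.

Definition upd (m : memory) (a x : nat) : memory :=
  fun i => if i == a then x else m i.

Definition frame (b : nat) (m : memory) : memory := fun i => m (b + i).

Definition unframe (b : nat) (m m' : memory) : memory :=
  fun i => if i < b then m i else m' (i - b).

(* [exec p m T m']: started in memory [m], [p] halts in memory [m'] after
   running for time [T]. *)
Inductive exec : prog -> memory -> nat -> memory -> Prop :=
| exec_skip m : exec Skip m 1 m
| exec_set a e m :
    exec (Put a e) m (cost a + cost e).+1 (upd m (eval m a) (eval m e))
| exec_seq p q m T1 m1 T2 m2 :
    exec p m T1 m1 -> exec q m1 T2 m2 -> exec (Seq p q) m (T1 + T2) m2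
| exec_if_true e p q m T m1 :
    eval m e != 0 -> exec p m T m1 -> exec (If e p q) m (cost e + T).+1 m1
| exec_if_false e p q m T m1 :
    eval m e = 0 -> exec q m T m1 -> exec (If e p q) m (cost e + T).+1 m1
| exec_while_stop e p m :
    eval m e = 0 -> exec (While e p) m (cost e).+1 m
| exec_while_step e p m T1 m1 T2 m2 :
    eval m e != 0 -> exec p m T1 m1 -> exec (While e p) m1 T2 m2 ->
    exec (While e p) m (cost e + T1 + T2).+1 m2
| exec_call e p m T m1 :
    exec p (frame (eval m e) m) T m1 ->
    exec (Call e p) m (cost e + T).+1 (unframe (eval m e) m m1).

(* Hence "the" running time and "the" output of a program are meaningful. *)
Lemma exec_det p m T1 m1 T2 m2 :
  exec p m T1 m1 -> exec p m T2 m2 -> T1 = T2 /\ m1 = m2.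
Proof.
move=> H; elim: H T2 m2 => {p m T1 m1}.
- by move=> m T2 m2 H; inversion H.
- by move=> a e m T2 m2 H; inversion H.
- move=> p q m T1 m1 T2 m2 _ IH1 _ IH2 T m' H.
  inversion H as [| |? ? ? ? ? ? ? E1 E2| | | | |]; subst.
  have [-> E] := IH1 _ _ E1; rewrite -E in E2.
  by have [-> ->] := IH2 _ _ E2.
- move=> e p q m T m1 He _ IH T' m' H.
  inversion H as [| | |? ? ? ? ? ? _ E|? ? ? ? ? ? E| | |]; subst.
  + by have [-> ->] := IH _ _ E.
  + by rewrite E in He.
- move=> e p q m T m1 He _ IH T' m' H.
  inversion H as [| | |? ? ? ? ? ? E|? ? ? ? ? ? _ E| | |]; subst.
  + by rewrite He in E.
  + by have [-> ->] := IH _ _ E.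
- move=> e p m He T' m' H.
  by inversion H as [| | | | | |? ? ? ? ? ? ? E|]; subst => //; rewrite He in E.
- move=> e p m T1 m1 T2 m2 He _ IH1 _ IH2 T' m' H.
  inversion H as [| | | | |? ? ? E|? ? ? ? ? ? ? _ E1 E2|]; subst.
  + by rewrite E in He.
  + have [-> E] := IH1 _ _ E1; rewrite -E in E2.
    by have [-> ->] := IH2 _ _ E2.
- move=> e p m T m1 _ IH T' m' H.
  inversion H as [| | | | | | |? ? ? ? ? E]; subst.
  by have [-> ->] := IH _ _ E.
Qed.

(* The color classes are numbered 0..n-1 and n..2n-1. *)
Definition vcode n (v : vertex n) : nat := v.1 * n + v.2.

Definition enc_mgraph n (D : mgraph n) : seq nat :=
  size D :: flatten [seq [:: vcode e.1; vcode e.2] | e <- D].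

Definition enc_paths n (P : seq (seq (vertex n))) : seq nat :=
  flatten [seq size p :: map (@vcode n) p | p <- P].

(* The instance (K_{n,n}, D): n, e(D) and the edges, all other cells being 0. *)
Definition instance n (D : mgraph n) : memory := nth 0 (n :: enc_mgraph D).

Definition stored (m : memory) (a : nat) (s : seq nat) : Prop :=
  forall i, i < size s -> m (a + i) = nth 0 s i.

(* A program returns the address of its output in cell 0. *)
Definition computes_realizations (A : prog) (t n : nat) : Prop :=
  forall D : mgraph n, loopless D -> maxdeg D <= t ->
    exists (T : nat) (m : memory) (P : seq (seq (vertex n))),
      [/\ exec A (instance D) T m,
          stored m (m 0) (enc_paths P) &
          realization D P].

(* Here there are two outputs, located by cells 0 and 1. *)
Definition outputs_realized n (m : memory) (D : mgraph n)
    (P : seq (seq (vertex n))) : Prop :=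
  stored m (m 0) (enc_mgraph D) /\ stored m (m 1) (enc_paths P).

(* Main.v *)
Require Import Defs.
From mathcomp Require Import all_boot all_order all_algebra zify.
From Stdlib Require Import FunctionalExtensionality.

(** A realizable multigraph has degrees at most [n], and the existence of the
    algorithm [A] forces [t <= n].  Start from an inclusion-maximal [X] in [D]
    of maximum degree at most [t], and replace an edge [xy] of [X] by two edges
    [xu], [yw] of [D] outside [X] whenever [u] and [w] can take one more edge
    each.  Degrees in [X] never decrease, so no new swap ever appears and one
    pass over the initial edges suffices; scanning the incidence lists of both
    ends of each of them costs [sum_v deg_X v * deg_D v = O(t e(D))].

    If no swap is left, let [f] be the number of edges of the optimum [Y]
    outside [X] with exactly one saturated end (degree [t] in [X]).  Counting
    saturated ends gives [2 t e(Y) <= 2 n e(X) + t f].  Let [Rp] be a maximal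
    [X]-independent set of saturated ends of these [f] edges: independence gives
    [t * #|Rp| <= e(X)], and the absence of swaps gives [f <= n * #|Rp|], whence
    [2 t e(Y) <= 3 n e(X)]. *)

Set Implicit Arguments.
Unset Strict Implicit.
Unset Printing Implicit Defensive.

(** * Time-bounded execution *)

(** Why [t <= n]: given [t] parallel edges, [A] must route [t] edge-disjoint paths out of a vertex
    with [n] neighbours. The same inequality turns the cost [O(t e(D))] into [O(e(D) n)]. The second
    half is shaped by the fact that [A] is only known to work when its memory is exactly an
    instance, with 0 in every further cell. So the working arrays are confined below a bound
    computed from [n] and [e(D)], the chosen graph is written above it, and [A] is called there; its
    paths stay where it leaves them, since copying them would cost time. This is why whole memories
    are shown equal, not merely equal on the cells in use. The two edges brought in by a swap may
    share their far end, and then that vertex must take two more edges. One candidate at each end of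
    the centre does not reveal whether a legal pair exists; four scans do. The constant must not
    depend on [t] or [A]: [t] enters the program only as a literal of unit cost. *)

Definition runs p m (b : nat) (Q : memory -> Prop) :=
  exists T m', [/\ exec p m T m', T <= b & Q m'].

Lemma runs_le p m b b' (Q : memory -> Prop) :
  runs p m b Q -> b <= b' -> runs p m b' Q.
Proof.
by move=> [T [m' [He Hb HQ]]] Hbb; exists T, m'; split=> //; apply: leq_trans Hb Hbb.
Qed.

Lemma runs_post p m b (Q Q' : memory -> Prop) :
  runs p m b Q -> (forall m', Q m' -> Q' m') -> runs p m b Q'.
Proof. by move=> [T [m' [He Hb HQ]]] H; exists T, m'; split=> //; apply: H. Qed.

Lemma runs_seq p q m b1 b2 (Q1 Q : memory -> Prop) :
  runs p m b1 Q1 -> (forall m1, Q1 m1 -> runs q m1 b2 Q) ->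
  runs (Seq p q) m (b1 + b2) Q.
Proof.
move=> [T1 [m1 [He1 Hb1 HQ1]]] /(_ _ HQ1) [T2 [m2 [He2 Hb2 HQ2]]].
by exists (T1 + T2), m2; split=> //; [apply: exec_seq He1 He2 | apply: leq_add].
Qed.

Lemma runs_if e p q m b (Q : memory -> Prop) :
  (eval m e != 0 -> runs p m b Q) -> (eval m e = 0 -> runs q m b Q) ->
  runs (If e p q) m (cost e + b).+1 Q.
Proof.
move=> Hp Hq; have [E|E] := eqVneq (eval m e) 0.
- have [T [m' [He Hb HQ]]] := Hq E; exists (cost e + T).+1, m'.
  by split=> //; [apply: exec_if_false | rewrite ltnS leq_add2l].
- have [T [m' [He Hb HQ]]] := Hp E; exists (cost e + T).+1, m'.
  by split=> //; [apply: exec_if_true | rewrite ltnS leq_add2l].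
Qed.

(** The cost may vary with the iteration, so that the scans of the swap phase can be summed over all
    centres instead of being bounded one by one. *)
Lemma runs_while e p N (c : nat -> nat) (I : nat -> memory -> Prop) m :
  I 0 m ->
  (forall k m', k < N -> I k m' ->
     eval m' e != 0 /\ runs p m' (c k) (I k.+1)) ->
  (forall m', I N m' -> eval m' e = 0) ->
  runs (While e p) m (\sum_(k < N) (cost e + c k).+1 + (cost e).+1) (I N).
Proof.
move=> I0 step stop.
suff H d k m' : k + d = N -> I k m' ->
    runs (While e p) m' (\sum_(k <= i < N) (cost e + c i).+1 + (cost e).+1) (I N).
  by rewrite -(big_mkord xpredT (fun i => (cost e + c i).+1)); apply: H I0.
elim: d k m' => [|d IH] k m' Hk Ik.
  rewrite addn0 in Hk; rewrite Hk big_geq // in Ik *.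
  by exists (cost e).+1, m'; split=> //; apply: exec_while_stop (stop _ Ik).
have ltkN : k < N by lia.
have [He [T1 [m1 [E1 B1 I1]]]] := step _ _ ltkN Ik.
have [|T2 [m2 [E2 B2 I2]]] := IH k.+1 m1 _ I1; first by lia.
exists (cost e + T1 + T2).+1, m2; split=> //; first exact: exec_while_step E1 E2.
by rewrite big_ltn //; lia.
Qed.

Fixpoint straight (p : prog) : bool :=
  match p with
  | Skip | Put _ _ => true
  | Seq p q | If _ p q => straight p && straight q
  | While _ _ | Call _ _ => false
  end.

Fixpoint run (p : prog) (m : memory) : memory :=
  match p with
  | Put a e => upd m (eval m a) (eval m e)
  | Seq p q => run q (run p m)
  | If e p q => if eval m e != 0 then run p m else run q m
  | _ => m
  end.

(** Both branches of [If] are added: only a constant is wanted, so a crude bound does. The value at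
    loops and calls is a dummy, excluded by [straight]. *)
Fixpoint wctime (p : prog) : nat :=
  match p with
  | Put a e => (cost a + cost e).+1
  | Seq p q => wctime p + wctime q
  | If e p q => (cost e + (wctime p + wctime q)).+1
  | _ => 1
  end.

Lemma runs_straight p m (Q : memory -> Prop) :
  straight p -> Q (run p m) -> runs p m (wctime p) Q.
Proof.
move=> sp HQ; suff [T [He Hb]] : exists T, exec p m T (run p m) /\ T <= wctime p.
  by exists T, (run p m).
move: {Q HQ} m; elim: p sp => //=.
- by move=> _ m; exists 1; split=> //; constructor.
- by move=> a e _ m; eexists; split; first exact: exec_set.
- move=> p IHp q IHq /andP[/IHp {}IHp /IHq {}IHq] m.
  have [T1 [E1 B1]] := IHp m; have [T2 [E2 B2]] := IHq (run p m).
  by exists (T1 + T2); split; [apply: exec_seq E1 E2 | apply: leq_add].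
- move=> e p IHp q IHq /andP[/IHp {}IHp /IHq {}IHq] m.
  have [E|E] := eqVneq (eval m e) 0.
  + have [T [He Hb]] := IHq m; exists (cost e + T).+1.
    by split; [apply: exec_if_false | lia].
  + have [T [He Hb]] := IHp m; exists (cost e + T).+1.
    by split; [apply: exec_if_true | lia].
Qed.

(** * Swap-free subgraphs *)

Section Charging.

Variables (V I : finType) (a b : I -> V).

Definition idx_deg (Z : {set I}) (v : V) := \sum_(i in Z) ((a i == v) + (b i == v)).

Definition links (i : I) (x z : V) : bool :=
  (a i == x) && (b i == z) || (a i == z) && (b i == x).

Lemma linksC i x z : links i x z = links i z x.
Proof. by rewrite /links orbC. Qed.

Lemma sum_idx_deg (Z : {set I}) (P : pred V) :
  \sum_(v | P v) idx_deg Z v = \sum_(i in Z) (P (a i) + P (b i)).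
Proof.
have E x : \sum_(v | P v) (x == v) = P x :> nat.
  rewrite -big_mkcondr /=; case Px: (P x).
    rewrite (eq_bigl (pred1 x)) ?big_pred1_eq // => v /=.
    by rewrite eq_sym; case: eqVneq => [->|]; rewrite ?Px ?andbF.
  by rewrite big_pred0 // => v; case: eqVneq => [<-|]; rewrite ?Px ?andbF.
by rewrite /idx_deg exchange_big /=; apply: eq_bigr => i _; rewrite big_split /= !E.
Qed.

Lemma card_incident_le (Z : {set I}) (v : V) (N : {set I}) :
  (forall i, i \in N -> (i \in Z) && ((a i == v) || (b i == v))) ->
  #|N| <= idx_deg Z v.
Proof.
move=> NZ; rewrite /idx_deg -sum1_card big_mkcond [leqRHS]big_mkcond /=.
apply: leq_sum => i _; case: ifP => // /NZ /andP[-> /orP[] ->] //.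
by rewrite addn1.
Qed.

Variables (t n : nat) (X Y : {set I}).

Hypothesis neq_ab : forall i, a i != b i.
Hypothesis degX : forall v, idx_deg X v <= t.
Hypothesis degY : forall v, idx_deg Y v <= n.
Hypothesis le_tn : t <= n.
Hypothesis maximalX :
  forall j, j \notin X -> t <= idx_deg X (a j) \/ t <= idx_deg X (b j).
Hypothesis no_swap : forall i j k u w,
  i \in X -> j \notin X -> k \notin X ->
  links j (a i) u -> links k (b i) w ->
  idx_deg X u < t -> idx_deg X w < t -> u = w.

Let sat v := t <= idx_deg X v.

Let half := [set i in Y :\: X | sat (a i) != sat (b i)].

Lemma half_ends i : i \in half ->
  exists x u, [/\ links i x u, sat x & ~~ sat u].
Proof.
rewrite inE => /andP[_]; case Sa: (sat (a i)); case Sb: (sat (b i)) => // _.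
- by exists (a i), (b i); rewrite /links !eqxx Sa Sb.
- by exists (b i), (a i); rewrite /links !eqxx Sa Sb orbT.
Qed.

(* The representatives form a maximal [X]-independent set [Rp] of saturated
   ends of half-saturated edges: independence gives [t * #|Rp| <= #|X|], and
   the absence of swaps lets every half-saturated edge be charged to some
   [r \in Rp] so that the edges charged to [r] share one vertex. *)
Lemma half_saturated_bound : t * #|half| <= n * #|X|.
Proof.
pose A := [set x | sat x & [exists i in half, exists u, links i x u && ~~ sat u]].
have AP x : x \in A -> exists i u, [/\ i \in half, links i x u & ~~ sat u].
  rewrite inE => /andP[_ /exists_inP[i hi /existsP[u /andP[l s]]]].
  by exists i, u.
have halfX i : i \in half -> i \notin X by rewrite !inE => /andP[/andP[]].
pose indep (W : {set V}) := (W \subset A) &&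
  [forall i in X, ~~ ((a i \in W) && (b i \in W))].
have [|Rp /maxsetP[/andP[sRA /forall_inP iR] maxR] _] :=
  @maxset_exists _ indep set0.
  rewrite /indep sub0set /=; apply/forall_inP => i _; by rewrite inE.
have leX : t * #|Rp| <= #|X|.
  rewrite mulnC -sum_nat_const.
  apply: (@leq_trans (\sum_(v in Rp) idx_deg X v)).
    apply: leq_sum => v vR; by move/(subsetP sRA): vR; rewrite inE => /andP[].
  rewrite sum_idx_deg -sum1_card; apply: leq_sum => i iX.
  by have := iR i iX => /=; do 2!case: (_ \in Rp).
pose adj x y := [exists i in X, links i x y].
(* Replacing the [X]-edge between [x] and [y] by [i] and [j] would be a swap, so the two unsaturated
   ends coincide. *)
have adjE x y i u j w : adj x y -> i \in half -> links i x u -> ~~ sat u ->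
    j \in half -> links j y w -> ~~ sat w -> u = w.
  move=> /exists_inP[e eX le] hi li su hj lj sw.
  have {}su : idx_deg X u < t by rewrite ltnNge.
  have {}sw : idx_deg X w < t by rewrite ltnNge.
  case/orP: le => /andP[/eqP E1 /eqP E2]; rewrite -E1 -E2 in li lj.
    by apply: no_swap eX (halfX _ hi) (halfX _ hj) li lj su sw.
  by apply/esym/(no_swap eX (halfX _ hj) (halfX _ hi) lj li sw su).
(* If [r] has an [X]-neighbour in [A], then by [adjE] all half-saturated edges at [r] and at its
   neighbours in [A] share one unsaturated end, which becomes [key r]. Otherwise only edges at [r]
   itself need charging, and [key r] is [r]. Either way the edges charged number at most the degree
   of [key r] in [Y]. *)
pose nb r := [exists y in A, adj r y].
pose uu r := [pick u | ~~ sat u & [exists i in half, links i r u]].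
pose key r := if nb r then odflt r (uu r) else r.
pose N r := [set i in half | (a i == key r) || (b i == key r)].
have cN r : #|N r| <= n.
  apply: leq_trans (degY (key r)); apply: card_incident_le => i.
  by rewrite !inE => /andP[/andP[/andP[_ ->] _] ->].
have keyE r i u x : r \in A -> adj x r -> i \in half -> links i x u ->
    ~~ sat u -> x \in A -> key r = u.
  move=> rA xr hi li su xA; rewrite /key.
  have rx : adj r x.
    by case/exists_inP: xr => e eX le; apply/exists_inP; exists e; rewrite 1?linksC.
  have -> : nb r by apply/exists_inP; exists x.
  rewrite /uu; case: pickP => /= [w' /andP[sw' /exists_inP[k hk lk]]|none].
    by rewrite -(adjE _ _ _ _ _ _ xr hi li su hk lk sw').
  have [k [w' [hk lk sw']]] := AP r rA.
  by move: (none w'); rewrite sw' /= => /exists_inP[]; exists k.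
have cov : half \subset \bigcup_(r in Rp) N r.
  apply/subsetP => i hi; have [x [u [li sx su]]] := half_ends hi.
  have xA : x \in A.
    by rewrite inE sx; apply/exists_inP; exists i => //; apply/existsP; exists u; rewrite li.
  have endu y : (y == x) || (y == u) -> (a i == y) || (b i == y).
    by case/orP: li => /andP[/eqP <- /eqP <-] /orP[/eqP ->|/eqP ->]; rewrite eqxx ?orbT.
  have [xR|xR] := boolP (x \in Rp).
    apply/bigcupP; exists x => //; rewrite inE hi; apply: endu.
    case nbx: (nb x); last by rewrite /key nbx eqxx.
    have/exists_inP[y yA xy] := nbx.
    rewrite /key nbx /uu; case: pickP => /= [w /andP[sw /exists_inP[k hk lk]]|]; last by rewrite eqxx.
    have [k' [w' [hk' lk' sw']]] := AP y yA.
    by rewrite (adjE _ _ _ _ _ _ xy hk lk sw hk' lk' sw')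
               (adjE _ _ _ _ _ _ xy hi li su hk' lk' sw') eqxx orbT.
  (* Otherwise [x] could be added to [Rp], against its maximality. *)
  have [r rR xr] : exists2 r, r \in Rp & adj x r.
    apply/exists_inP; apply/contraT; rewrite negb_exists_in => /forall_inP nadj.
    have : indep (x |: Rp).
      rewrite /indep subUset sub1set xA sRA /=; apply/forall_inP => e eX.
      apply/negP; rewrite !inE => /andP[/orP[/eqP ea|ea] /orP[/eqP eb|eb]].
      - by have := neq_ab e; rewrite ea eb eqxx.
      - have := nadj _ eb; rewrite /adj => /exists_inP[]; exists e => //.
        by rewrite /links ea !eqxx.
      - have := nadj _ ea; rewrite /adj => /exists_inP[]; exists e => //.
        by rewrite /links eb !eqxx orbT.
      - by have := iR e eX; rewrite ea eb.
    move/maxR => /(_ (subsetUr _ _)) /setP /(_ x).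
    by rewrite !inE eqxx (negPf xR).
  apply/bigcupP; exists r => //; rewrite inE hi; apply: endu.
  by rewrite (keyE r i u x (subsetP sRA _ rR) xr hi li su xA) eqxx orbT.
have le1 : #|half| <= n * #|Rp|.
  apply: leq_trans (subset_leq_card cov) _.
  rewrite mulnC -sum_nat_const.
  apply: (big_rec2 (fun (W : {set I}) k => #|W| <= k)) => [|r W k _ Wk].
    by rewrite cards0.
  by apply: leq_trans (leq_card_setU _ _) _; apply: leq_add.
apply: leq_trans (leq_mul (leqnn t) le1) _.
by rewrite mulnCA leq_mul.
Qed.

Lemma swap_free_ratio : 2 * t * #|Y| <= 3 * n * #|X|.
Proof.
pose sc i := sat (a i) + sat (b i).
have sc2 i : sc i <= 2 by rewrite /sc; do 2!case: (sat _).
pose S := [set v | sat v].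
have EY : \sum_(i in Y) sc i <= n * #|S|.
  rewrite /sc -sum_idx_deg mulnC -sum_nat_const.
  rewrite (eq_bigl (fun v => v \in S)) => [|v]; last by rewrite inE.
  by apply: leq_sum.
have EX : \sum_(i in X) sc i = t * #|S|.
  rewrite /sc -sum_idx_deg mulnC -sum_nat_const.
  rewrite (eq_bigl (fun v => v \in S)) => [|v]; last by rewrite inE.
  by apply: eq_bigr => v; rewrite inE => sv; apply/eqP; rewrite eqn_leq degX.
have cY : 2 * #|Y| = \sum_(i in Y) sc i + \sum_(i in Y) (2 - sc i).
  rewrite -big_split /= mulnC -sum_nat_const; apply: eq_bigr => i _.
  by rewrite subnKC.
have cX : 2 * #|X| = \sum_(i in X) sc i + \sum_(i in X) (2 - sc i).
  rewrite -big_split /= mulnC -sum_nat_const; apply: eq_bigr => i _.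
  by rewrite subnKC.
(* By maximality an edge of [Y] outside [X] has a saturated end, so it contributes at most 1, and 1
   only when it lies in [half]. *)
have splitY : \sum_(i in Y) (2 - sc i) <= \sum_(i in X) (2 - sc i) + #|half|.
  rewrite -sum1_card big_mkcond [X in _ <= X + _]big_mkcond.
  rewrite [X in _ <= _ + X]big_mkcond -big_split /=; apply: leq_sum => i _.
  rewrite !inE; case iY: (i \in Y) => //; case iX: (i \in X) => /=; first exact: leq_addr.
  rewrite /sc; have := maximalX (negbT iX); rewrite -/(sat _) -/(sat _).
  by case: (sat _); case: (sat _) => //= [[]].
(* With [s = #|S|] and [f = #|half|], the facts above give [2 |Y| <= n s + (2 |X| - t s) + f].
   Multiplying by [t] and using [t (2 |X| - t s) <= n (2 |X| - t s)] yields
   [2 t |Y| <= 2 n |X| + t f]. *)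
have := half_saturated_bound.
nia.
Qed.

End Charging.

(** * Realizable multigraphs *)

Lemma vcode_inj n : injective (@vcode n).
Proof.
move=> [x i] [y j]; rewrite /vcode /= => E; have := ltn_ord i; have := ltn_ord j.
case: x y E => [] [] /= E hj hi; try lia; congr (_, _); apply: val_inj => /=; lia.
Qed.

Lemma vcode_lt n (v : vertex n) : vcode v < n + n.
Proof. by case: v => [[] i]; rewrite /vcode /=; have := ltn_ord i; lia. Qed.

Lemma joinsC n (e : vertex n * vertex n) u v : joins e u v = joins e v u.
Proof. by rewrite /joins orbC. Qed.

Lemma path_edge_first n (x y : vertex n) q : mult (path_edges (x :: y :: q)) x y != 0.
Proof. by rewrite /mult /= /joins eqxx. Qed.

Lemma path_edge_last n (x : vertex n) q y :
  mult (path_edges (rcons (x :: q) y)) (last x q) y != 0.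
Proof.
rewrite /mult /path_edges /=; elim: q x => [|z q IH] x /=.
  by rewrite /joins eqxx.
by rewrite addn_eq0 negb_and IH orbT.
Qed.

Lemma path_for_neighbour n (e : vertex n * vertex n) p v :
  path_for e p -> e.1 != e.2 -> (e.1 == v) || (e.2 == v) ->
  exists2 w, Knn v w & mult (path_edges p) v w != 0.
Proof.
case: p => // x q /and3P[pth _ jn] ne ev.
have xl : x != last x q.
  by case/orP: jn ne => /eqP -> //=; rewrite eq_sym.
have {ev} : (v == x) || (v == last x q).
  by case/orP: jn ev => /eqP -> /=; rewrite ![_ == v]eq_sym // orbC.
case/orP=> /eqP ->.
  case: q pth xl {jn} => [|y q] /=; first by rewrite eqxx.
  by case/andP=> xy _ _; exists y => //; exact: path_edge_first.
case/lastP: q pth xl {jn} => [|q y]; first by rewrite eqxx.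
rewrite last_rcons rcons_path => /andP[_ k] _; exists (last x q).
  by rewrite /Knn eq_sym.
rewrite -rcons_cons; have := path_edge_last x q y; rewrite /mult.
by under eq_count => e' do rewrite joinsC.
Qed.

Lemma card_Knn n (v : vertex n) : #|[pred w | Knn v w]| = n.
Proof.
have -> : #|[pred w | Knn v w]| = #|[set (~~ v.1, i) | i in 'I_n]|.
  apply: eq_card => -[c i]; rewrite inE /Knn /=; apply/idP/imsetP => [h|[j _ [-> _]]].
    by exists i => //; congr (_, _); case: v.1 c h => [] [].
  by case: v.1.
by rewrite card_imset ?card_ord // => i j [].
Qed.

Lemma disjoint_paths_share n (P : seq (seq (vertex n))) v w :
  pairwise (@edge_disjoint n) P ->
  \sum_(p <- P) (mult (path_edges p) v w != 0) <= 1.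
Proof.
elim: P => [|p P IH]; first by rewrite big_nil.
rewrite pairwise_cons big_cons => /andP[/allP dis /IH {}IH].
case E: (mult (path_edges p) v w != 0) => //=.
rewrite big1_seq // => q /andP[_ /dis]; rewrite /edge_disjoint => /allP H.
apply/eqP; rewrite eqb0 negbK; move: E; rewrite /mult -lt0n -has_count.
case/hasP=> e eP je; have := H e eP; rewrite /mult.
suff /eq_count -> : (fun e' : vertex n * vertex n => joins e' e.1 e.2) =1
   (fun e' => joins e' v w) by [].
by move=> e'; case/orP: je => /eqP -> //=; rewrite joinsC.
Qed.

(** Each edge at [v] is charged to an edge of [K_{n,n}] at [v] on its path; by disjointness none of
    these is charged twice, and there are [n] of them. Without loops, an edge counts at most once in
    the degree and its path is not a single vertex. *)
Lemma realizable_deg n (D : mgraph n) v : loopless D -> realizable D -> deg D v <= n.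
Proof.
move=> lD [P /andP[DP dis]].
have le1 : deg D v <= \sum_(p <- P) \sum_(w | Knn v w) (mult (path_edges p) v w != 0).
  elim: D P lD DP {dis} => [|e D IH] [|p P] //=; first by rewrite /deg !big_nil.
  case/andP=> ne lD /andP[ep DP]; rewrite /deg !big_cons.
  apply: leq_add; last exact: IH.
  case Ev: ((e.1 == v) || (e.2 == v)); last first.
    by case/norP: (negbT Ev) => /negbTE -> /negbTE ->.
  have [w kw mw] := path_for_neighbour ep ne Ev.
  rewrite (bigD1 w) //= mw; move: ne; case: (e.1 =P v) => [->|_].
    by rewrite eq_sym => /negbTE ->.
  by case: (_ == v).
apply: leq_trans le1 _; rewrite exchange_big /= -[X in _ <= X](card_Knn v) -sum1_card.
by apply: leq_sum => w _; apply: disjoint_paths_share.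
Qed.

Lemma computes_le n t A : 0 < n -> computes_realizations A t n -> t <= n.
Proof.
move=> n0 cA; pose o := Ordinal n0.
pose e : vertex n * vertex n := ((false, o), (true, o)).
have degE v : deg (nseq t e) v = t * ((e.1 == v) + (e.2 == v)).
  by rewrite /deg big_nseq iter_addn addn0 mulnC.
have lD : loopless (nseq t e) by rewrite /loopless all_nseq orbT.
have [|T [m [P [_ _ rP]]]] := cA _ lD.
  apply/bigmax_leqP => v _; rewrite degE; case: eqP => [<-|_]; rewrite /= ?addn0 ?muln1 //.
  by case: (_ == v); rewrite ?muln0 ?muln1.
have := @realizable_deg _ _ (false, o) lD (ex_intro _ P rP).
by rewrite degE eqxx muln1.
Qed.

(** A canonical orientation turns multiplicities of unordered pairs into plain occurrence counts, to
    which [count_subseqP] applies. *)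
Definition nrm n (e : vertex n * vertex n) :=
  if vcode e.1 <= vcode e.2 then e else (e.2, e.1).

Lemma nrm_joins n (e : vertex n * vertex n) u v :
  vcode u <= vcode v -> (nrm e == (u, v)) = joins e u v.
Proof.
case: e => x y uv; rewrite /nrm /joins /=; case: leqP => xy; rewrite !xpair_eqE.
  case: (eqVneq x v) => [Ex|_]; case: (eqVneq y u) => [Ey|_]; rewrite /= ?orbF ?andbF //.
  subst x y; have /vcode_inj -> : vcode u = vcode v by lia.
  by rewrite eqxx.
rewrite andbC; case: (eqVneq x u) => [Ex|_]; case: (eqVneq y v) => [Ey|_]; rewrite /= ?orbF //.
by subst x y; lia.
Qed.

Lemma deg_nrm n (D : mgraph n) v : deg (map (@nrm n) D) v = deg D v.
Proof.
rewrite /deg big_map; apply: eq_bigr => e _; rewrite /nrm.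
by case: ifP => // _; rewrite addnC.
Qed.

(** Passing to a set of positions forgets the order and orientation of the edges of [D'], but keeps
    its size and degrees, which is all that the counting argument sees. *)
Lemma submgraph_mask n (D' D : mgraph n) : submgraph D' D ->
  exists2 bs : seq bool, size (mask bs D) = size D' &
    forall v, deg (mask bs D) v = deg D' v.
Proof.
move=> sub; have : forall e, count_mem e (map (@nrm n) D') <= count_mem e (map (@nrm n) D).
  case=> u v; rewrite !count_map; case: (leqP (vcode u) (vcode v)) => uv.
    rewrite (eq_count (a2 := fun e => joins e u v)) => [|e]; last exact: nrm_joins.
    rewrite [leqRHS](eq_count (a2 := fun e => joins e u v)) => [|e]; last exact: nrm_joins.
    exact: sub.
  (* No normalized edge has decreasing codes. *)
  rewrite (@eq_count _ _ pred0) ?count_pred0 // => -[x y] /=.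
  by apply/negbTE/eqP; rewrite /nrm /=; case: leqP => xy [E1 E2]; subst; lia.
move/count_subseqP => [s /subseqP[bs _ ->]]; rewrite -map_mask => pe.
exists bs => [|v] /=.
  by rewrite -[LHS](size_map (@nrm n)) -(perm_size pe) size_map.
by rewrite -[LHS]deg_nrm -[RHS]deg_nrm /deg (perm_big _ pe).
Qed.

Lemma submgraph_of_mask n (D : mgraph n) bs : submgraph (mask bs D) D.
Proof. by move=> u v; apply/leq_count_subseq/mask_subseq. Qed.

Lemma loopless_sub n (D' D : mgraph n) : submgraph D' D -> loopless D -> loopless D'.
Proof.
move=> sub /allP lD; apply/allP => -[u v] eD /=; apply/negP => /eqP E; subst v.
have : 0 < mult D u u.
  apply: leq_trans (sub u u); rewrite /mult -has_count; apply/hasP.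
  by exists (u, u) => //; rewrite /joins eqxx.
rewrite /mult -has_count => /hasP[e /lD ne]; rewrite /joins orbb => /eqP E.
by rewrite E eqxx in ne.
Qed.

Section Indexing.

Variables (n : nat) (D : mgraph n).

(** Edges are indexed by their positions in [D], so that parallel edges are distinct elements of a
    finite type. *)
Definition end1 (i : 'I_(size D)) := (tnth (in_tuple D) i).1.
Definition end2 (i : 'I_(size D)) := (tnth (in_tuple D) i).2.

Lemma mask_idx_deg (bs : seq bool) v :
  deg (mask bs D) v = idx_deg end1 end2 [set i : 'I_(size D) | nth false bs i] v.
Proof.
rewrite /deg /idx_deg big_mask.
by apply: eq_bigl => i; rewrite inE andbT.
Qed.

Lemma mask_card (bs : seq bool) :
  size (mask bs D) = #|[set i : 'I_(size D) | nth false bs i]|.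
Proof.
rewrite -sum1_size -sum1_card big_mask.
by apply: eq_bigl => i; rewrite inE andbT.
Qed.

End Indexing.

(** * Greedy selection and swaps *)

Section Status.

Variables (m t : nat) (a b : nat -> nat).

Definition inc j v := (a j == v) + (b j == v).

Definition sdeg (st : nat -> nat) v := \sum_(j < m) (st j != 0) * inc j v.

Definition joinn e x z := (a e == x) && (b e == z) || (a e == z) && (b e == x).

Definition avail st e x z := [&& e < m, st e == 0, joinn e x z & sdeg st z < t].

(** If both new edges end in the same vertex, it needs room for two. *)
Definition compat st u w := (u != w) || (sdeg st u + 2 <= t).

Definition swappable st x y :=
  exists j k u w, [/\ avail st j x u, avail st k y w & compat st u w].

Lemma upd_same (f : nat -> nat) i x : upd f i x i = x.
Proof. by rewrite /upd eqxx. Qed.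

(** Additive on both sides, to avoid truncated subtraction. *)
Lemma sdeg_upd st i x v : i < m ->
  sdeg (upd st i x) v + (st i != 0) * inc i v = sdeg st v + (x != 0) * inc i v.
Proof.
move=> im; rewrite /sdeg (bigD1 (Ordinal im)) //= [in RHS](bigD1 (Ordinal im)) //= upd_same.
rewrite [in LHS](eq_bigr (fun j : 'I_m => (st j != 0) * inc j v)); first by lia.
by move=> j /eqP jn; rewrite /upd ifN //; apply/eqP => E; apply: jn; apply: val_inj.
Qed.

(* A status is 0 for an edge outside [X], 1 for an edge chosen greedily and 2 for
   an edge brought in by a swap. *)
Record greedy_inv st i := GreedyInv {
  greedy_deg : forall v, sdeg st v <= t;
  greedy_max : forall j, j < i -> st j = 0 -> t <= sdeg st (a j) \/ t <= sdeg st (b j);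
  greedy_later : forall j, i <= j -> st j = 0;
  greedy_le1 : forall j, st j <= 1 }.

Lemma greedy_init : greedy_inv (fun=> 0) 0.
Proof. by split=> // v; rewrite /sdeg big1. Qed.

Lemma greedy_skip st i : greedy_inv st i ->
  t <= sdeg st (a i) \/ t <= sdeg st (b i) -> greedy_inv st i.+1.
Proof.
move=> [dt mx lt l1] H; split=> // j ji; last by apply: lt; lia.
have [->|jn] := eqVneq j i; first by [].
by apply: mx; lia.
Qed.

Lemma greedy_take st i : i < m -> a i != b i -> greedy_inv st i ->
  sdeg st (a i) < t -> sdeg st (b i) < t ->
  greedy_inv (upd st i 1) i.+1 /\
  (forall v, sdeg (upd st i 1) v = sdeg st v + inc i v).
Proof.
move=> im nab [dt mx lt l1] da db.
have E v : sdeg (upd st i 1) v = sdeg st v + inc i v.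
  by have := sdeg_upd st 1 v im; rewrite lt //= mul0n addn0 mul1n.
split=> //; split=> [v|j ji|j ij|j].
- rewrite E /inc; case: (a i =P v) => [<-|_].
    by rewrite eq_sym (negbTE nab); lia.
  by case: eqP => [<-|_]; rewrite ?addn1 ?addn0.
- rewrite /upd; case: eqP => // jn sj; rewrite -!/(upd _ _ _) !E.
  by case: (mx j _ sj) => [|h|h]; [lia|left|right]; apply: leq_trans h _; apply: leq_addr.
- by rewrite /upd; case: eqP => [|_]; [lia|apply: lt; lia].
- by rewrite /upd; case: eqP.
Qed.

(** An edge of status 2 counts as done even if its index is still ahead, because it is never tried
    as a centre. *)
Record swap_inv st i := SwapInv {
  swap_deg : forall v, sdeg st v <= t;
  swap_max : forall j, j < m -> st j = 0 -> t <= sdeg st (a j) \/ t <= sdeg st (b j);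
  swap_done : forall j, j < m -> st j = 2 \/ (st j <> 0 /\ j < i) ->
    ~ swappable st (a j) (b j) }.

Lemma swap_init st : greedy_inv st m -> swap_inv st 0.
Proof. by case=> dt mx lt l1; split=> // j jm [E|[]] //; have := l1 j; rewrite E. Qed.

Lemma swap_skip st i : swap_inv st i -> ~ swappable st (a i) (b i) \/ st i != 1 /\ st i <= 2 ->
  swap_inv st i.+1.
Proof.
move=> [dt mx dn] H; split=> // j jm [sj|[sj ji]]; first by apply: dn => //; left.
have [E|jn] := eqVneq j i; last by apply: dn => //; right; split=> //; lia.
case: H => [|[s1 s2]]; first by rewrite E.
by apply: dn => //; left; rewrite E in sj *; lia.
Qed.

(** An edge outside [X] has a saturated end by maximality, and this is not its far end [u]. Hence
    both ends of the centre of a swap are saturated. *)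
Lemma avail_sat st i j x u : swap_inv st i -> avail st j x u -> t <= sdeg st x.
Proof.
move=> [dt mx dn] /and4P[jm /eqP sj jn ut].
by case/orP: jn (mx j jm sj) => /andP[/eqP -> /eqP ->] []; lia.
Qed.

(* Degrees never decrease and the removed edge [i] has two saturated ends, so no
   edge becomes available; hence edges already rejected as swap centres stay
   rejected, and the new edges, having an end that was unsaturated, are rejected
   as well. *)
Lemma swap_step st i j k u w : i < m -> a i != b i -> st i = 1 ->
  swap_inv st i -> avail st j (a i) u -> avail st k (b i) w -> compat st u w ->
  let st' := upd (upd (upd st i 0) j 2) k 2 in
  swap_inv st' i.+1 /\ (forall v, sdeg st' v = sdeg st v + (u == v) + (w == v)).
Proof.
move=> im nab si inv aj ak cuw st'.
have sa := avail_sat inv aj; have sb := avail_sat inv ak.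
case: (inv) => dt mx dn.
case/and4P: (aj) => jm /eqP sj jj ut; case/and4P: (ak) => km /eqP sk jk wt.
have ji : j != i by apply/eqP => E; rewrite E si in sj.
have ki : k != i by apply/eqP => E; rewrite E si in sk.
(* A common edge would join the two ends of [i], and its far end would be saturated. *)
have kj : k != j.
  apply/eqP => E; subst k; case/orP: jj => /andP[/eqP E1 /eqP E2];
  case/orP: jk => /andP[/eqP E3 /eqP E4].
  - by rewrite E1 in E3; rewrite E3 eqxx in nab.
  - by rewrite -E3 E1 in wt; lia.
  - by rewrite E2 in E4; rewrite -E4 in wt; lia.
  - by rewrite E2 in E4; rewrite E4 eqxx in nab.
have incj v : inc j v = (a i == v) + (u == v).
  by rewrite /inc; case/orP: jj => /andP[/eqP -> /eqP ->] //; rewrite addnC.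
have inck v : inc k v = (b i == v) + (w == v).
  by rewrite /inc; case/orP: jk => /andP[/eqP -> /eqP ->] //; rewrite addnC.
have E v : sdeg st' v = sdeg st v + (u == v) + (w == v).
  have := sdeg_upd (upd (upd st i 0) j 2) 2 v km.
  have := sdeg_upd (upd st i 0) 2 v jm; have := sdeg_upd st 0 v im.
  rewrite -/st' incj inck [in (_ != 0) * inc i v]si /inc.
  have -> : upd st i 0 j = 0 by rewrite /upd ifN.
  have -> : upd (upd st i 0) j 2 k = 0 by rewrite /upd !ifN.
  by rewrite /=; lia.
have ge v : sdeg st v <= sdeg st' v by rewrite E; lia.
have stE e : e <> i -> st' e = 0 -> st e = 0.
  move=> /eqP ei; rewrite /st' /upd; case: eqP => // _; case: eqP => // _.
  by rewrite (negbTE ei).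
have st'i : st' i = 0.
  by rewrite /st' /upd !(eq_sym i) (negbTE ki) (negbTE ji) eqxx.
(* The removed edge [i] does not become available: its ends stay saturated, since degrees only
   grow. *)
have av e x z : avail st' e x z -> avail st e x z.
  case/and4P=> em /eqP se je zt; have zt' : sdeg st z < t by have := ge z; lia.
  have ei : e <> i.
    by move=> Ei; subst e; case/orP: je => /andP[/eqP E1 /eqP E2]; subst; lia.
  by rewrite /avail em (stE e) // eqxx je zt'.
have sw x y : swappable st' x y -> swappable st x y.
  move=> [e1 [e2 [z1 [z2 [v1 v2 c]]]]]; exists e1, e2, z1, z2; split; [exact: av v1|exact: av v2|].
  case/orP: c => c; apply/orP; [by left|right].
  by have := ge z1; lia.
(* An edge outside [X] between two unsaturated vertices would contradict maximality. *)
have nou z e : sdeg st z < t -> forall x, ~ avail st' e z x.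
  move=> zt x /av /and4P[em /eqP se je xt].
  by case/orP: je (mx e em se) => /andP[/eqP -> /eqP ->] []; lia.
have nosw e x z : joinn e x z -> sdeg st z < t -> ~ swappable st' (a e) (b e).
  move=> je zt [e1 [e2 [z1 [z2 [v1 v2 _]]]]].
  case/orP: je => /andP[/eqP E1 /eqP E2]; subst.
    exact: nou zt _ v2.
  exact: nou zt _ v1.
split=> //; split=> [v|e em se|e em H].
- rewrite E; case: (u =P v) => [Eu|_]; case: (w =P v) => [Ew|_] /=.
  + by subst; move: cuw; rewrite /compat eqxx /=; lia.
  + by subst; lia.
  + by subst; lia.
  + by rewrite !addn0.
- have [->|/eqP ei] := eqVneq e i; first by left; have := ge (a i); lia.
  case: (mx e em (stE e ei se)) => h; [left|right].
  + by have := ge (a e); lia.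
  + by have := ge (b e); lia.
- have [Ek|/eqP ek] := eqVneq e k; first by subst e; exact: nosw jk wt.
  have [Ej|/eqP ej] := eqVneq e j; first by subst e; exact: nosw jj ut.
  have [Ei|/eqP ei] := eqVneq e i; first by subst e; rewrite st'i in H; case: H => [|[]].
  have Es : st' e = st e.
    by rewrite /st' /upd; move/eqP/negbTE: ek => ->; move/eqP/negbTE: ej => ->;
       move/eqP/negbTE: ei => ->.
  move/sw; apply: dn => //; rewrite -Es; case: H => [|[h1 h2]]; [by left|right].
  by split=> //; lia.
Qed.

End Status.

(** * The program *)

Notation "p ;; q" := (Seq p q) (at level 60, right associativity).

(* Cell [R + 8 i + f] holds entry [i] of array [f], and cell 1 holds [R].  Array 0
   is the register file, 1 the start of edges, 2 the end of half-edges, 3 the links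
   of the incidence lists, 4 the edge of a half-edge, 5 the status of edges, 6 the
   heads of the incidence lists and 7 the degrees.  Lists store a half-edge [h]
   as [h + 1], 0 being the end of the list. *)
Definition dbl e := Add e e.
Definition addr f e := Add (Get (Cst 1)) (Add (dbl (dbl (dbl e))) (Cst f)).
Definition arr f e := Get (addr f e).
Definition reg k := arr 0 (Cst k).
Definition aput f e x := Put (addr f e) x.
Definition rput k x := aput 0 (Cst k) x.

Definition arrays := nat -> nat -> nat.

Definition updF (F : arrays) f i x : arrays :=
  fun g j => if (g == f) && (j == i) then x else F g j.

(** * Interleaved arrays in memory *)

Section Layout.

Variables (R : nat) (base : memory).
Hypotheses (R_gt1 : 1 < R) (base1 : base 1 = R).

Definition mem (F : arrays) : memory :=
  fun c => if c < R then base c else F ((c - R) %% 8) ((c - R) %/ 8).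

Lemma mem_cell F f i : f < 8 -> mem F (R + (8 * i + f)) = F f i.
Proof.
move=> f8; rewrite /mem ltnNge leq_addr /= addKn mulnC modnMDl modn_small //.
by rewrite divnMDl // divn_small // addn0.
Qed.

Lemma upd_mem F f i x : f < 8 -> upd (mem F) (R + (8 * i + f)) x = mem (updF F f i x).
Proof.
move=> f8; apply: functional_extensionality => c; rewrite /upd /mem /updF.
case: ltnP => cR; first by rewrite ifN //; lia.
case: eqP => [->|ne]; last rewrite ifN //.
  rewrite addKn mulnC modnMDl modn_small // divnMDl // divn_small // addn0.
  by rewrite !eqxx.
by apply/negP => /andP[/eqP E1 /eqP E2]; apply: ne; have := divn_eq (c - R) 8; lia.
Qed.

Lemma eval_addr F f e : eval (mem F) (addr f e) = R + (8 * eval (mem F) e + f).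
Proof. by rewrite /= {1}/mem R_gt1 base1; lia. Qed.

Lemma eval_arr F f e : f < 8 -> eval (mem F) (arr f e) = F f (eval (mem F) e).
Proof. by move=> f8; rewrite -(mem_cell F _ f8) -eval_addr. Qed.

Lemma eval_reg F k : eval (mem F) (reg k) = F 0 k.
Proof. by rewrite eval_arr. Qed.

Lemma run_aput F f e x : f < 8 ->
  run (aput f e x) (mem F) = mem (updF F f (eval (mem F) e) (eval (mem F) x)).
Proof. by move=> f8; rewrite -upd_mem // -eval_addr. Qed.

Lemma run_rput F k x : run (rput k x) (mem F) = mem (updF F 0 k (eval (mem F) x)).
Proof. by rewrite run_aput. Qed.

End Layout.

Lemma run_seq p q m : run (p ;; q) m = run q (run p m). Proof. by []. Qed.
Lemma run_ifE e p q m :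
  run (If e p q) m = if eval m e != 0 then run p m else run q m.
Proof. by []. Qed.
Lemma run_skip m : run Skip m = m. Proof. by []. Qed.
Lemma eval_add m e f : eval m (Add e f) = eval m e + eval m f. Proof. by []. Qed.
Lemma eval_sub m e f : eval m (Defs.Sub e f) = eval m e - eval m f. Proof. by []. Qed.
Lemma eval_cst m k : eval m (Cst k) = k. Proof. by []. Qed.
Lemma eval_get m e : eval m (Get e) = m (eval m e). Proof. by []. Qed.
Lemma eval_dbl m e : eval m (dbl e) = eval m e + eval m e. Proof. by []. Qed.

Definition evE := (run_seq, run_skip, eval_add, eval_sub, eval_cst, eval_dbl).

Lemma updFE F f i x g j : updF F f i x g j = if (g == f) && (j == i) then x else F g j.
Proof. by []. Qed.

#[local] Arguments run : simpl never.
#[local] Arguments eval : simpl never.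

Notation rM := 0. Notation rI := 1. Notation rCur := 2. Notation rAvoid := 3.
Notation rCnt := 8. Notation rOut := 9. Notation rFrame := 10.
Notation rT := 11. Notation rNone := 12.

Definition load_body :=
  let i := reg rI in let i' := Add (reg rM) i in
  aput 1 i (Get (Add (dbl i) (Cst 2))) ;;
  aput 2 i (Get (Add (dbl i) (Cst 3))) ;;
  aput 2 i' (arr 1 i) ;;
  aput 4 i i ;;
  aput 4 i' i ;;
  aput 3 i (arr 6 (arr 1 i)) ;;
  aput 6 (arr 1 i) (Add i (Cst 1)) ;;
  aput 3 i' (arr 6 (arr 2 i)) ;;
  aput 6 (arr 2 i) (Add i' (Cst 1)) ;;
  If (Defs.Sub (reg rT) (arr 7 (arr 1 i)))
    (If (Defs.Sub (reg rT) (arr 7 (arr 2 i)))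
      (aput 5 i (Cst 1) ;;
       aput 7 (arr 1 i) (Add (arr 7 (arr 1 i)) (Cst 1)) ;;
       aput 7 (arr 2 i) (Add (arr 7 (arr 2 i)) (Cst 1)))
      Skip)
    Skip ;;
  rput rI (Add i (Cst 1)).

(** The scan does not stop at a hit, so the last suitable half-edge is kept. In truncated arithmetic
    [(z - avoid) + (avoid - z)] is nonzero iff [z] differs from [avoid], and [t - (d + 1)] is
    nonzero iff [d + 2 <= t]; the sum of the two expresses [compat]. *)
Definition find_body r :=
  let h := Defs.Sub (reg rCur) (Cst 1) in let z := arr 2 h in
  If (arr 5 (arr 4 h)) Skip
    (If (Defs.Sub (reg rT) (arr 7 z))
      (If (Add (Add (Defs.Sub z (reg rAvoid)) (Defs.Sub (reg rAvoid) z))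
               (Defs.Sub (reg rT) (Add (arr 7 z) (Cst 1))))
        (rput r (reg rCur)) Skip) Skip) ;;
  rput rCur (arr 3 h).

Definition find_init ve we r :=
  rput rCur (arr 6 ve) ;; rput rAvoid we ;; rput r (Cst 0).

Definition find ve we r := find_init ve we r ;; While (reg rCur) (find_body r).

(** Each end of the centre loses one edge and gains one, so only the degrees of the far ends are
    updated. *)
Definition commit rj rk :=
  let j := Defs.Sub (reg rj) (Cst 1) in let k := Defs.Sub (reg rk) (Cst 1) in
  aput 5 (reg rI) (Cst 0) ;;
  aput 5 (arr 4 j) (Cst 2) ;;
  aput 5 (arr 4 k) (Cst 2) ;;
  aput 7 (arr 2 j) (Add (arr 7 (arr 2 j)) (Cst 1)) ;;
  aput 7 (arr 2 k) (Add (arr 7 (arr 2 k)) (Cst 1)).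

Definition decide :=
  let alt := If (reg 6) (If (reg 7) (commit 7 6) Skip) Skip in
  If (reg 4) (If (reg 5) (commit 4 5) alt) alt.

(* Registers 4 to 7 receive half-edges at the ends [x], [y] of the centre: any
   one at [x], one at [y] compatible with it, any one at [y], and one at [x]
   compatible with that. *)
Definition centre :=
  let x := arr 1 (reg rI) in let y := arr 2 (reg rI) in
  find x (reg rNone) 4 ;;
  find y (arr 2 (Defs.Sub (reg 4) (Cst 1))) 5 ;;
  find y (reg rNone) 6 ;;
  find x (arr 2 (Defs.Sub (reg 6) (Cst 1))) 7 ;;
  decide.

Definition swap_body :=
  If (arr 5 (reg rI)) (If (Defs.Sub (arr 5 (reg rI)) (Cst 1)) Skip centre) Skip ;;
  rput rI (Add (reg rI) (Cst 1)).

(** Register 4 stands for any target register: the cost does not depend on its number. *)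
Definition scan_time := (cost (reg rCur) + wctime (find_body 4)).+1.

Definition centre_const :=
  let x := arr 1 (reg rI) in let y := arr 2 (reg rI) in
  wctime (find_init x (reg rNone) 4) +
  wctime (find_init y (arr 2 (Defs.Sub (reg 4) (Cst 1))) 5) +
  wctime (find_init y (reg rNone) 6) +
  wctime (find_init x (arr 2 (Defs.Sub (reg 6) (Cst 1))) 7) +
  4 * (cost (reg rCur)).+1 + wctime decide.

Definition next_i := rput rI (Add (reg rI) (Cst 1)).
Definition more_i := Defs.Sub (reg rM) (reg rI).

Definition swap_const :=
  (cost (arr 5 (reg rI)) +
   (cost (Defs.Sub (arr 5 (reg rI)) (Cst 1)) + centre_const.+1).+1).+1 + wctime next_i.

(** Each chosen edge is written twice, to the output and to the instance prepared for [A], where it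
    is shifted by one cell because [n] comes first. Both counts are refreshed at once, so that after
    every round the two areas encode the edges chosen so far. *)
Definition out_body :=
  let i := reg rI in let k := dbl (reg rCnt) in
  If (arr 5 i)
    (Put (Add (reg rOut) (Add k (Cst 1))) (arr 1 i) ;;
     Put (Add (reg rOut) (Add k (Cst 2))) (arr 2 i) ;;
     Put (Add (reg rFrame) (Add k (Cst 2))) (arr 1 i) ;;
     Put (Add (reg rFrame) (Add k (Cst 3))) (arr 2 i) ;;
     rput rCnt (Add (reg rCnt) (Cst 1)) ;;
     Put (Add (reg rOut) (Cst 0)) (reg rCnt) ;;
     Put (Add (reg rFrame) (Cst 1)) (reg rCnt))
    Skip ;;
  next_i.

(** The address returned by [A] is relative to its frame, hence the addition of the base. Cell 1 is
    overwritten last, because every register is reached through it. *)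
Definition finish A :=
  Call (reg rFrame) A ;;
  Put (Cst 0) (reg rOut) ;;
  Put (Cst 1) (Add (reg rFrame) (Get (reg rFrame))).

Definition finish_time :=
  (cost (reg rFrame)).+1 + ((1 + cost (reg rOut)).+1 +
    (1 + cost (Add (reg rFrame) (Get (reg rFrame)))).+1).

Definition out_init := rput rI (Cst 0) ;; Put (Add (reg rFrame) (Cst 0)) (Get (Cst 0)).

(** The number [m] of edges is first saved in cell [2 m + 2], just past the input; this cell becomes
    register [rM] once cell 1 holds its address. The length [2 m + 2 n + 16] of the arrays leaves
    room for half-edges, vertices and registers, and the output area takes [2 m + 1] cells. *)
Definition setup t :=
  Put (Add (dbl (Get (Cst 1))) (Cst 2)) (Get (Cst 1)) ;;
  Put (Cst 1) (Add (dbl (Get (Cst 1))) (Cst 2)) ;;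
  rput rT (Cst t) ;;
  rput rNone (dbl (Get (Cst 0))) ;;
  rput rOut (Add (Get (Cst 1))
    (dbl (dbl (dbl (Add (Add (dbl (reg rM)) (reg rNone)) (Cst 16)))))) ;;
  rput rFrame (Add (reg rOut) (Add (dbl (reg rM)) (Cst 1))).

Definition main :=
  While more_i load_body ;;
  rput rI (Cst 0) ;;
  While more_i swap_body ;;
  out_init ;;
  While more_i out_body.

Definition main_const :=
  (cost more_i + wctime load_body).+1 + (cost more_i).+1 + wctime (rput rI (Cst 0)) +
  (cost more_i + swap_const).+1 + 4 * scan_time + (cost more_i).+1 + wctime out_init +
  (cost more_i + wctime out_body).+1 + (cost more_i).+1.

Definition flat (l : seq (nat * nat)) : seq nat :=
  size l :: flatten [seq [:: e.1; e.2] | e <- l].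

Lemma size_flat l : size (flat l) = (size l + size l).+1.
Proof. by rewrite /flat /=; elim: l => //= e l /= [->]; lia. Qed.

Lemma flat_rcons l e c : nth 0 (flat (rcons l e)) c =
  upd (upd (upd (nth 0 (flat l)) (size l + size l + 1) e.1)
    (size l + size l + 2) e.2) 0 (size l + 1) c.
Proof.
have := size_flat l; rewrite /flat /= => -[sz]; rewrite /upd; case: c => [|c] /=; first by rewrite size_rcons addn1.
rewrite map_rcons flatten_rcons nth_cat sz.
case: ltnP => h; first by do 2!(rewrite ifN; last by lia).
have [->|ne1] := eqVneq c (size l + size l).
  by rewrite subnn /= ifN ?ifT //; lia.
have [->|ne2] := eqVneq c (size l + size l).+1.
  by rewrite ifT ?subSn ?subnn //; lia.
do 2!(rewrite ifN; last by lia).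
by rewrite !nth_default /= ?sz //; lia.
Qed.

Fixpoint chain (nxt : nat -> nat) (h : nat) (l : seq nat) : Prop :=
  if l is x :: l' then h = x.+1 /\ chain nxt (nxt x) l' else h = 0.

Lemma eq_chain nxt nxt' h l : chain nxt h l -> {in l, nxt =1 nxt'} -> chain nxt' h l.
Proof.
elim: l h => //= x l IH h [-> ch] E; split=> //; rewrite -E ?mem_head //.
by apply: IH => // y yl; apply: E; rewrite inE yl orbT.
Qed.

(** * Half-edges and incidence lists *)

Section Run.

Variables (n m t : nat) (a b : nat -> nat).
Hypothesis a_lt : forall j, j < m -> a j < n + n.
Hypothesis b_lt : forall j, j < m -> b j < n + n.
Hypothesis neq_ab : forall j, j < m -> a j != b j.

Notation R := (m + m + 2).
Notation L := (m + m + (n + n) + 16).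
Notation Q := (R + 8 * L).

(* Half-edge [j < m] leaves [a j] and half-edge [m + j] leaves [b j]. *)
Fixpoint hlist i v : seq nat :=
  if i is i'.+1 then
    (if b i' == v then [:: m + i'] else [::]) ++
    (if a i' == v then [:: i'] else [::]) ++ hlist i' v
  else [::].

Lemma mem_hlist i v h :
  reflect (exists2 j, j < i & (h = j /\ a j = v) \/ (h = m + j /\ b j = v))
          (h \in hlist i v).
Proof.
elim: i => [|i IH] /=; first by constructor=> -[].
apply: (iffP idP).
  rewrite !mem_cat => /or3P[| |/IH[j ji H]]; last by exists j => //; lia.
    by case: eqP => // E; rewrite inE => /eqP ->; exists i => //; right.
  by case: eqP => // E; rewrite inE => /eqP ->; exists i => //; left.
move=> [j ji H]; rewrite !mem_cat; have [E|ne] := eqVneq j i.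
  subst j; case: H => -[-> ->]; rewrite eqxx inE eqxx ?orbT //.
by apply/or3P/Or33/IH; exists j => //; lia.
Qed.

Lemma size_hlist i v : size (hlist i v) = \sum_(j < i) inc a b j v.
Proof.
elim: i => [|i IH]; first by rewrite big_ord0.
by rewrite big_ord_recr /= !size_cat -IH /inc; do 2!case: ifP => _ /=; lia.
Qed.

(** Guarantees that all cells from [Q] on are still 0, as the instance later built there for [A]
    demands. *)
Definition supp (F : arrays) := forall f j, L <= j -> F f j = 0.

Lemma supp_updF F f i x : supp F -> i < L -> supp (updF F f i x).
Proof.
move=> sF iL g j Lj; rewrite updFE; case: andP => [[_ /eqP E]|_]; first by lia.
exact: sF.
Qed.

Variable base : memory.
Hypothesis base0 : base 0 = n.
Hypothesis base1 : base 1 = R.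
Hypothesis base_a : forall j, j < m -> base (j + j + 2) = a j.
Hypothesis base_b : forall j, j < m -> base (j + j + 3) = b j.

Local Notation mem := (mem R base).

Lemma R_gt1 : 1 < R. Proof. by rewrite addn2. Qed.

Lemma eval_arr' F f e : f < 8 -> eval (mem F) (arr f e) = F f (eval (mem F) e).
Proof. exact: (eval_arr R_gt1 base1). Qed.

Lemma eval_reg' F k : eval (mem F) (reg k) = F 0 k.
Proof. exact: (eval_reg R_gt1 base1). Qed.

Lemma run_aput' F f e x : f < 8 ->
  run (aput f e x) (mem F) = mem (updF F f (eval (mem F) e) (eval (mem F) x)).
Proof. exact: (run_aput R_gt1 base1). Qed.

Lemma run_rput' F k x : run (rput k x) (mem F) = mem (updF F 0 k (eval (mem F) x)).
Proof. exact: (run_rput R_gt1 base1). Qed.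

Lemma mem_base F c : c < R -> mem F c = base c.
Proof. by rewrite /mem => ->. Qed.

(** * Loading the edges and choosing greedily *)

Record regs_ok (F : arrays) : Prop := RegsOk {
  reg_m : F 0 rM = m; reg_t : F 0 rT = t; reg_none : F 0 rNone = n + n;
  reg_out : F 0 rOut = Q; reg_frame : F 0 rFrame = Q + (m + m + 1);
  reg_cnt : F 0 rCnt = 0 }.

Record graph_ok (F : arrays) i : Prop := GraphOk {
  arr_src : forall j, j < i -> F 1 j = a j;
  arr_dst : forall j, j < i -> F 2 j = b j;
  arr_dst' : forall j, j < i -> F 2 (m + j) = a j;
  arr_eid : forall j, j < i -> F 4 j = j;
  arr_eid' : forall j, j < i -> F 4 (m + j) = j;
  arr_chain : forall v, chain (F 3) (F 6 v) (hlist i v) }.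

Record load_inv i (M : memory) (F : arrays) : Prop := LoadInv {
  load_mem : M = mem F;
  load_i : F 0 rI = i;
  load_regs : regs_ok F;
  load_graph : graph_ok F i;
  load_greedy : greedy_inv m t a b (F 5) i;
  load_deg : forall v, F 7 v = sdeg m a b (F 5) v;
  load_supp : supp F }.

Lemma load_step i M F : i < m -> load_inv i M F ->
  exists F', load_inv i.+1 (run load_body M) F'.
Proof.
move=> im [-> Fi rF gF greF dF sF].
have [rm rt _ _ _ _] := rF; have [h1 h2 h2' h4 h4' h3] := gF.
have ai := a_lt im; have bi := b_lt im; have nab := neq_ab im.
rewrite /load_body !evE run_aput' // eval_get !evE !eval_reg' Fi mem_base ?base_a; try lia.
rewrite run_aput' // eval_get !evE !eval_reg' !updFE /= Fi mem_base ?base_b; try lia.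
do 7!(rewrite run_aput' // !(evE, eval_reg', eval_arr') // !updFE /= ?eqxx /= ?Fi ?rm).
have imi : (i == m + i) = false by lia.
rewrite imi eqxx (eq_sym (b i)) (negbTE nab).
set G := updF _ 6 _ _.
have G5 : G 5 = F 5 by []. have G0 : G 0 = F 0 by []. have G7 : G 7 = F 7 by [].
have G1i : G 1 i = a i by rewrite /G !updFE /= eqxx.
have G2i : G 2 i = b i by rewrite /G !updFE /= eqxx imi.
have sG : supp G by rewrite /G; do 9!(apply: supp_updF; last lia).
have gG : graph_ok G i.+1.
  split.
  - by move=> j ji; rewrite /G !updFE /=; case: eqP => [->//|ne]; apply: h1; lia.
  - move=> j ji; rewrite /G !updFE /=; case: eqP => [|_]; first by lia.
    by case: eqP => [->//|ne]; apply: h2; lia.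
  - move=> j ji; rewrite /G !updFE /= eqn_add2l; case: eqP => [->//|ne].
    by rewrite ifN; [apply: h2'; lia | lia].
  - move=> j ji; rewrite /G !updFE /=; case: eqP => [|_]; first by lia.
    by case: eqP => [->//|ne]; apply: h4; lia.
  - move=> j ji; rewrite /G !updFE /= eqn_add2l; case: eqP => [->//|ne].
    by rewrite ifN; [apply: h4'; lia | lia].
  - move=> v.
    (* Only the links of the two new half-edges are written, and neither is on an old list. *)
    have chv : chain (G 3) (F 6 v) (hlist i v).
      apply: eq_chain (h3 v) _ => h /mem_hlist[j ji H].
      rewrite /G !updFE /=; case: eqP => [|_]; first by lia.
      by case: eqP => [|_]; first by lia.
    have G6 : G 6 v = if v == b i then (m + i).+1 else if v == a i then i.+1 else F 6 v.
      by rewrite /G !updFE /= !addn1.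
    have G3i : G 3 i = F 6 (a i) by rewrite /G !updFE /= imi eqxx.
    have G3m : G 3 (m + i) = F 6 (b i) by rewrite /G !updFE /= eqxx.
    rewrite /= G6 ![_ == v]eq_sym; case: eqP => [Ev|_] /=.
      by rewrite Ev (eq_sym (b i)) (negbTE nab) /= G3m -Ev.
    by case: eqP => [Ev|_] //=; rewrite G3i -Ev.
have rG : regs_ok G by case: rF.
have greG : greedy_inv m t a b (G 5) i by rewrite G5.
have dG v : G 7 v = sdeg m a b (G 5) v by rewrite G5 G7.
have Gi : G 0 1 = i by rewrite G0.
have Gt : G 0 rT = t by rewrite G0.
clearbody G; clear imi Fi rF gF dF sF rm rt h1 h2 h2' h4 h4' h3 greF G0 G5 G7 F.
have skip : t <= sdeg m a b (G 5) (a i) \/ t <= sdeg m a b (G 5) (b i) ->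
    exists F', load_inv i.+1 (run (rput rI (Add (reg rI) (Cst 1))) (mem G)) F'.
  move=> H; rewrite run_rput' !(evE, eval_reg') Gi addn1; exists (updF G 0 rI i.+1).
  split=> //; [by case: rG | by case: gG | exact: greedy_skip |].
  by apply: supp_updF => //; lia.
rewrite run_ifE !(evE, eval_reg', eval_arr') // Gt Gi G1i dG subn_eq0.
have [da|da] := leqP t _; first by apply: skip; left.
rewrite run_ifE !(evE, eval_reg', eval_arr') // Gt Gi G2i dG subn_eq0.
have [db|db] := leqP t _; first by apply: skip; right.
have [inv' dE] := greedy_take im nab greG da db.
rewrite /=.
do 3!(rewrite run_aput' // !(evE, eval_reg', eval_arr') // ?updFE /= ?Gi ?G1i ?G2i).
rewrite run_rput' !(evE, eval_reg') !updFE /= Gi !addn1 eq_sym (negbTE nab).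
set F' := updF _ 0 _ _; exists F'; split=> //.
- by case: rG.
- by case: gG.
- move=> v; rewrite (_ : F' 5 = upd (G 5) i 1) // dE -!dG /F' !updFE /= /inc !(eq_sym v).
  case: (b i =P v) => [Eb|_]; first by rewrite -Eb (negbTE nab) addn1.
  by case: eqP => [Ea|_]; rewrite ?Ea ?addn0 ?addn1.
- by rewrite /F'; do 4!(apply: supp_updF; last lia).
Qed.

Lemma load_loop M F : load_inv 0 M F ->
  runs (While more_i load_body) M
    (m * (cost more_i + wctime load_body).+1 + (cost more_i).+1)
    (fun M' => exists F', load_inv m M' F').
Proof.
move=> H0; apply: runs_le.
- apply: (@runs_while _ _ m (fun=> wctime load_body)
    (fun i M' => exists F', load_inv i M' F')); first by exists F.
  + move=> i M' im [G HG]; split.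
      case: HG => -> Gi [rm _ _ _ _ _] _ _ _ _.
      by rewrite evE !eval_reg' rm Gi subn_eq0 -ltnNge.
    by apply: runs_straight => //; apply: load_step HG.
  + move=> M' [G [-> Gi [rm _ _ _ _ _] _ _ _ _]].
    by rewrite evE !eval_reg' rm Gi subnn.
- by rewrite sum_nat_const card_ord.
Qed.

(** * Scanning an incidence list *)

Definition same (ks : seq nat) (F G : arrays) :=
  (forall f, 0 < f -> G f = F f) /\ (forall k, k \notin ks -> G 0 k = F 0 k).

Lemma same_upd ks F G k x : same ks F G -> k \in ks -> same ks F (updF G 0 k x).
Proof.
move=> [sa sr] kk; split=> [f f0|k' k'k].
  rewrite -(sa f f0); apply: functional_extensionality => j.
  by rewrite updFE; case: f f0.
by rewrite updFE /=; case: eqP => [E|_]; [rewrite E kk in k'k | exact: sr].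
Qed.

Lemma same_trans ks F G H : same ks F G -> same ks G H -> same ks F H.
Proof.
move=> [a1 r1] [a2 r2]; split=> [f f0|k kk]; first by rewrite a2 ?a1.
by rewrite r2 ?r1.
Qed.

Lemma same_sub ks ks' F G : same ks F G -> {subset ks <= ks'} -> same ks' F G.
Proof. by move=> [sa sr] sub; split=> // k kk; apply: sr; apply: contra kk; apply: sub. Qed.

Definition suits (F : arrays) w h :=
  [&& F 5 (F 4 h) == 0, F 7 (F 2 h) < t & (F 2 h != w) || (F 7 (F 2 h) + 2 <= t)].

Definition pick_suiting F w (l : seq nat) :=
  foldl (fun r h => if suits F w h then h.+1 else r) 0 l.

Lemma pick_suitingP F w l :
  (pick_suiting F w l = 0 /\ forall h, h \in l -> ~~ suits F w h) \/
  exists h, [/\ h \in l, suits F w h & pick_suiting F w l = h.+1].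
Proof.
elim/last_ind: l => [|l h IH]; first by left.
rewrite /pick_suiting foldl_rcons -/(pick_suiting _ _ _).
case E: (suits F w h); first by right; exists h; rewrite mem_rcons mem_head.
case: IH => [[-> H]|[h' [h'l sh' ->]]]; last first.
  by right; exists h'; rewrite mem_rcons inE h'l orbT.
left; split=> // h'; rewrite mem_rcons inE => /predU1P[->|]; last exact: H.
by rewrite E.
Qed.

Lemma find_step F w r G h l : 3 < r < 8 -> F 0 rT = t ->
  same [:: rCur; rAvoid; r] F G -> G 0 rAvoid = w -> chain (F 3) (G 0 rCur) (h :: l) ->
  exists G', [/\ run (find_body r) (mem G) = mem G',
    same [:: rCur; rAvoid; r] F G', G' 0 rAvoid = w, chain (F 3) (G' 0 rCur) l &
    G' 0 r = if suits F w h then h.+1 else G 0 r].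
Proof.
move=> r38 Ft sG Gw [Gc ch].
have Gt : G 0 rT = t by case: sG => _ ->; rewrite // !inE; lia.
have [r2 r3] : (2 == r) = false /\ (3 == r) = false by lia.
have r2' : (r == 2) = false by lia.
have Ga f : 0 < f -> G f = F f by case: sG => sa _; apply: sa.
pose G1 := if suits F w h then updF G 0 r h.+1 else G.
have E1 : run (find_body r) (mem G) = run (rput rCur (arr 3 (Defs.Sub (reg rCur) (Cst 1)))) (mem G1).
  rewrite /find_body run_seq; congr run.
  rewrite run_ifE !(evE, eval_reg', eval_arr') // Gc subn1 /= !Ga // /G1 /suits.
  have [_|_] := eqVneq (F 5 _) 0; rewrite /= ?run_skip //.
  rewrite run_ifE !(evE, eval_reg', eval_arr') // Gc Gt subn1 /= !Ga // subn_eq0 -ltnNge.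
  case: ltnP => dz /=; rewrite ?run_skip //.
  rewrite run_ifE !(evE, eval_reg', eval_arr') // Gc Gt Gw subn1 /= !Ga //.
  rewrite run_rput' eval_reg' Gc.
  set c1 := _ + _ + _ != 0; set c2 := _ || _; suff -> : c1 = c2 by case: c2.
  rewrite /c1 /c2; lia.
have sG1 : same [:: rCur; rAvoid; r] F G1.
  by rewrite /G1; case: ifP => // _; apply: same_upd => //; rewrite !inE eqxx !orbT.
have G1c : G1 0 rCur = h.+1 by rewrite /G1; case: ifP => // _; rewrite updFE /= r2.
have G1a : G1 0 rAvoid = w by rewrite /G1; case: ifP => // _; rewrite updFE /= r3.
rewrite E1 run_rput' !(evE, eval_reg', eval_arr') // G1c subn1 /=.
have -> : G1 3 = F 3 by case: sG1 => sa _; rewrite sa.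
exists (updF G1 0 rCur (F 3 h)); split=> //.
- by apply: same_upd => //.
- by rewrite updFE /= r2' /G1; case: ifP => // _; rewrite updFE !eqxx.
Qed.

Lemma find_runs F ve we v w r l : 3 < r < 8 -> F 0 rT = t ->
  (forall G, same [:: rCur; rAvoid; r] F G -> eval (mem G) ve = v) ->
  (forall G, same [:: rCur; rAvoid; r] F G -> eval (mem G) we = w) ->
  chain (F 3) (F 6 v) l ->
  runs (find ve we r) (mem F)
    (wctime (find_init ve we r) +
      (size l * scan_time + (cost (reg rCur)).+1))
    (fun M => exists G, [/\ M = mem G, same [:: rCur; rAvoid; r] F G &
                            G 0 r = pick_suiting F w l]).
Proof.
move=> r38 Ft Hv Hw ch.
have [r2 r3] : (2 == r) = false /\ (3 == r) = false by lia.
pose I k M := exists G, [/\ M = mem G, same [:: rCur; rAvoid; r] F G, G 0 rAvoid = w,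
  chain (F 3) (G 0 rCur) (drop k l) & G 0 r = pick_suiting F w (take k l)].
have I0 : I 0 (run (find_init ve we r) (mem F)).
  pose G1 := updF F 0 rCur (F 6 v).
  have s1 : same [:: rCur; rAvoid; r] F G1 by apply: same_upd.
  pose G2 := updF G1 0 rAvoid w.
  have s2 : same [:: rCur; rAvoid; r] F G2 by apply: same_upd.
  exists (updF G2 0 r 0); split.
  - rewrite /find_init !evE run_rput' eval_arr' // Hv //.
    by rewrite -/G1 run_rput' Hw // -/G2 run_rput' evE.
  - by apply: same_upd => //; rewrite !inE eqxx !orbT.
  - by rewrite updFE /= r3.
  - by rewrite drop0 updFE /= r2.
  - by rewrite take0 updFE !eqxx.
apply: (runs_seq (Q1 := I 0)); first by apply: runs_straight.
move=> M IM; apply: (runs_post (Q := I (size l))).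
- have -> : scan_time = (cost (reg rCur) + wctime (find_body r)).+1 by [].
  rewrite -[X in X * _](card_ord (size l)) -sum_nat_const.
  apply: (@runs_while _ _ (size l) (fun=> wctime (find_body r)) I) => //.
  + move=> k M' kl [G [-> sG Gw Gc Gr]]; rewrite (drop_nth 0 kl) in Gc.
    split; first by case: Gc => E _; rewrite eval_reg' E.
    apply: runs_straight => //.
    have [G' [-> s' w' c' r']] := find_step r38 Ft sG Gw Gc; exists G'; split=> //.
    by rewrite (take_nth 0 kl) /pick_suiting foldl_rcons -/(pick_suiting _ _ _) -Gr.
  + by move=> M' [G [-> _ _ Gc _]]; rewrite drop_size /= in Gc; rewrite eval_reg'.
- move=> M' [G [-> sG _ _ Gr]]; exists G; split=> //.
  by rewrite Gr take_size.
Qed.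

(** * The swap loop *)

Record swap_ok (st0 : nat -> nat) i (F : arrays) : Prop := SwapOk {
  swap_regs : regs_ok F;
  swap_graph : graph_ok F m;
  swap_invF : swap_inv m t a b (F 5) i;
  swap_degF : forall v, F 7 v = sdeg m a b (F 5) v;
  swap_le2 : forall j, F 5 j <= 2;
  swap_eq1 : forall j, F 5 j = 1 -> st0 j = 1;
  swap_supp : supp F }.

Lemma hlist_joinn F v h : graph_ok F m -> h \in hlist m v ->
  [/\ F 4 h < m, joinn a b (F 4 h) v (F 2 h) & F 2 h < n + n].
Proof.
move=> [_ h2 h2' h4 h4' _] /mem_hlist[j jm [[-> E]|[-> E]]].
  by rewrite h4 // h2 // /joinn E !eqxx; split=> //; apply: b_lt.
by rewrite h4' // h2' // /joinn E !eqxx orbT; split=> //; apply: a_lt.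
Qed.

Lemma joinn_hlist F v z e : graph_ok F m -> e < m -> joinn a b e v z ->
  exists h, [/\ h \in hlist m v, F 4 h = e & F 2 h = z].
Proof.
move=> [_ h2 h2' h4 h4' _] em /orP[]/andP[/eqP E1 /eqP E2].
  exists e; rewrite h2 // h4 //; split=> //; apply/mem_hlist; exists e => //; by left.
exists (m + e); rewrite h2' // h4' //; split=> //; apply/mem_hlist; exists e => //; by right.
Qed.

Lemma compatC st u w : compat m t a b st u w = compat m t a b st w u.
Proof. by rewrite /compat; case: (eqVneq u w) => [->|]. Qed.

Lemma suitsP st0 i F v w h : swap_ok st0 i F -> h \in hlist m v ->
  suits F w h = avail m t a b (F 5) (F 4 h) v (F 2 h) && compat m t a b (F 5) (F 2 h) w.
Proof.
move=> ok /(hlist_joinn (swap_graph ok)) [h4 hj _]; rewrite /suits /avail /compat.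
by rewrite h4 hj (swap_degF ok) /= andbA.
Qed.

Lemma pick_found st0 i F v w : swap_ok st0 i F ->
  let r := pick_suiting F w (hlist m v) in
  (r = 0 /\ forall e z, avail m t a b (F 5) e v z -> ~ compat m t a b (F 5) z w) \/
  exists h, [/\ r = h.+1, h \in hlist m v, avail m t a b (F 5) (F 4 h) v (F 2 h) &
             compat m t a b (F 5) (F 2 h) w].
Proof.
move=> ok r; case: (pick_suitingP F w (hlist m v)) => [[r0 H]|[h [hl sh rh]]]; last first.
  by right; exists h; move: sh; rewrite (suitsP w ok hl) => /andP[].
left; split=> // e z av cp; case/and4P: (av) => em _ je _.
have [h [hl he hz]] := joinn_hlist (swap_graph ok) em je.
by have := H h hl; rewrite (suitsP w ok hl) he hz av cp.
Qed.

Lemma same_graph_ok ks F G i : same ks F G -> graph_ok F i -> graph_ok G i.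
Proof. by move=> [sa _] [? ? ? ? ? ?]; split; rewrite !sa. Qed.

Lemma commit_ok st0 i F rj rk hj hk : i < m -> swap_ok st0 i F -> F 5 i = 1 ->
  F 0 rI = i -> F 0 rj = hj.+1 -> F 0 rk = hk.+1 ->
  hj \in hlist m (a i) -> hk \in hlist m (b i) ->
  avail m t a b (F 5) (F 4 hj) (a i) (F 2 hj) ->
  avail m t a b (F 5) (F 4 hk) (b i) (F 2 hk) ->
  compat m t a b (F 5) (F 2 hj) (F 2 hk) ->
  exists F', [/\ run (commit rj rk) (mem F) = mem F', swap_ok st0 i.+1 F' & F' 0 rI = i].
Proof.
move=> im ok Fi F0i Frj Frk jl kl aj ak c.
have [jm _ ju] := hlist_joinn (swap_graph ok) jl.
have [km _ kw] := hlist_joinn (swap_graph ok) kl.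
have [inv' dE] := swap_step im (neq_ab im) Fi (swap_invF ok) aj ak c.
rewrite /commit !evE.
do 5!(rewrite run_aput' // !(evE, eval_reg', eval_arr') // ?updFE /= ?F0i ?Frj ?Frk ?subn1 /=).
set F' := updF _ _ _ _; exists F'; split=> //.
have F'5 : F' 5 = upd (upd (upd (F 5) i 0) (F 4 hj) 2) (F 4 hk) 2 by [].
split.
- by case: (swap_regs ok).
- by case: (swap_graph ok).
- by rewrite F'5.
- move=> v; rewrite F'5 dE -(swap_degF ok) /F' !updFE /= !(eq_sym v).
  case: (F 2 hk =P v) => [Ek|_]; rewrite ?Ek ?(eq_sym v).
    by case: eqP => [<-|]; rewrite ?addn0.
  by case: eqP => [<-|]; rewrite ?addn0.
- move=> j; rewrite F'5 /upd; case: eqP => // _; case: eqP => // _; case: eqP => // _.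
  exact: swap_le2 ok j.
- move=> j; rewrite F'5 /upd; case: eqP => // _; case: eqP => // _; case: eqP => // _.
  exact: swap_eq1 ok j.
- by rewrite /F'; do 5!(apply: supp_updF; last lia); exact: swap_supp ok.
Qed.

Lemma same_swap_ok st0 i ks F G : same ks F G -> {subset ks <= [:: 2; 3; 4; 5; 6; 7]} ->
  swap_ok st0 i F -> swap_ok st0 i G.
Proof.
move=> sFG sub [rF gF iF dF lF eF sF]; have [sa sr] := same_sub sFG sub.
split; rewrite ?sa //.
- by case: rF => *; split; rewrite sr.
- exact: same_graph_ok sFG gF.
- move=> f j Lj; case: (posnP f) => [->|f0]; last by rewrite sa ?sF.
  by rewrite sr ?sF // !inE; lia.
Qed.

(** Completeness of the four scans: if the first finds a half-edge to [u] and the second nothing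
    compatible, then every available edge at [b i] ends in [u]. So the third scan, if it finds
    anything, also yields [u]; every possible swap uses [u] on that side, and the fourth scan finds
    a partner for [u] if there is one. *)
Lemma decide_ok st0 i F : i < m -> swap_ok st0 i F -> F 5 i = 1 -> F 0 rI = i ->
  F 0 4 = pick_suiting F (n + n) (hlist m (a i)) ->
  F 0 5 = pick_suiting F (F 2 (F 0 4).-1) (hlist m (b i)) ->
  F 0 6 = pick_suiting F (n + n) (hlist m (b i)) ->
  F 0 7 = pick_suiting F (F 2 (F 0 6).-1) (hlist m (a i)) ->
  exists F', [/\ run decide (mem F) = mem F', swap_ok st0 i.+1 F' & F' 0 rI = i].
Proof.
move=> im ok Fi F0i E4 E5 E6 E7.
(* Vertex codes are below [n + n], so avoiding the value [n + n] excludes nothing. *)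
have nc e v z : avail m t a b (F 5) e v z -> compat m t a b (F 5) z (n + n).
  move=> /and4P[em _ /orP[]/andP[/eqP E1 /eqP E2] _]; rewrite /compat.
    by have := b_lt em; rewrite E2; lia.
  by have := a_lt em; rewrite E1; lia.
have := pick_found (a i) (n + n) ok; rewrite /= -E4 => P4.
have := pick_found (b i) (F 2 (F 0 4).-1) ok; rewrite /= -E5 => P5.
have := pick_found (b i) (n + n) ok; rewrite /= -E6 => P6.
have := pick_found (a i) (F 2 (F 0 6).-1) ok; rewrite /= -E7 => P7.
rewrite /decide !run_ifE !eval_reg' !run_skip.
case: P4 => [[Z4 no4]|[h4 [Z4 l4 a4 _]]].
  have nosw : ~ swappable m t a b (F 5) (a i) (b i).
    by move=> [j [k [u [w [aj _ _]]]]]; case: (no4 _ _ aj); apply: nc aj.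
  (* An available edge at [a i] would have been found by the first scan. *)
  case: P7 => [[Z7 _]|[h7 [_ _ a7 _]]]; last by case: (no4 _ _ a7); apply: nc a7.
  rewrite Z4 Z7 /=; exists F; case: ifP => _; split=> //; case: ok => *; split=> //;
  by apply: swap_skip => //; left.
rewrite Z4 /= in P5 *.
case: P5 => [[Z5 no5]|[h5 [Z5 l5 a5 c5]]]; last first.
  rewrite Z5 /=; rewrite compatC in c5.
  exact: commit_ok im ok Fi F0i Z4 Z5 l4 l5 a4 a5 c5.
rewrite Z5 /=.
case: P6 => [[Z6 no6]|[h6 [Z6 l6 a6 _]]].
  have nosw : ~ swappable m t a b (F 5) (a i) (b i).
    by move=> [j [k [u [w [_ ak _]]]]]; case: (no6 _ _ ak); apply: nc ak.
  rewrite Z6 /=; exists F; split=> //; case: ok => *; split=> //.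
  by apply: swap_skip => //; left.
rewrite Z6 /= in P7 *.
case: P7 => [[Z7 no7]|[h7 [Z7 l7 a7 c7]]]; last first.
  by rewrite Z7 /=; exact: commit_ok im ok Fi F0i Z7 Z6 l7 l6 a7 a6 c7.
rewrite Z7 /=; exists F; split=> //.
have nosw : ~ swappable m t a b (F 5) (a i) (b i).
  move=> [j [k [u [w [aj ak cuw]]]]].
  have eqn4 z e : avail m t a b (F 5) e (b i) z -> z = F 2 h4.
    by move=> az; apply/eqP/negPn/negP => ne; apply: (no5 _ _ az); rewrite /compat ne.
  case: (no7 _ _ aj); rewrite (eqn4 _ _ a6) -(eqn4 _ _ ak) //.
case: ok => *; split=> //; by apply: swap_skip => //; left.
Qed.

Lemma pick_suiting_same ks F G w l :
  same ks F G -> pick_suiting G w l = pick_suiting F w l.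
Proof. by move=> [sa _]; rewrite /pick_suiting /suits !sa. Qed.

Lemma centre_runs st0 i F : i < m -> swap_ok st0 i F -> F 5 i = 1 -> F 0 rI = i ->
  runs centre (mem F)
    (centre_const + 2 * scan_time * (size (hlist m (a i)) + size (hlist m (b i))))
    (fun M => exists F', [/\ M = mem F', swap_ok st0 i.+1 F' & F' 0 rI = i]).
Proof.
move=> im ok Fi F0i.
have Ex ks G : same ks F G -> rI \notin ks -> eval (mem G) (arr 1 (reg rI)) = a i.
  move=> [sa sr] ni; rewrite eval_arr' // eval_reg' sa // sr // F0i.
  exact: arr_src (swap_graph ok) i im.
have Ey ks G : same ks F G -> rI \notin ks -> eval (mem G) (arr 2 (reg rI)) = b i.
  move=> [sa sr] ni; rewrite eval_arr' // eval_reg' sa // sr // F0i.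
  exact: arr_dst (swap_graph ok) i im.
have En ks G : same ks F G -> rNone \notin ks -> eval (mem G) (reg rNone) = n + n.
  by move=> [_ sr] ni; rewrite eval_reg' sr //; case: (swap_regs ok).
have Et ks G : same ks F G -> rT \notin ks -> G 0 rT = t.
  by move=> [_ sr] ni; rewrite sr //; case: (swap_regs ok).
have ch ks G v : same ks F G -> chain (G 3) (G 6 v) (hlist m v).
  by move=> [sa _]; rewrite !sa //; case: (swap_graph ok).
have ks4 : {subset [:: 2; 3; 4] <= [:: 2; 3; 4; 5; 6; 7]} by apply/allP.
have ks5 : {subset [:: 2; 3; 5] <= [:: 2; 3; 4; 5; 6; 7]} by apply/allP.
have ks6 : {subset [:: 2; 3; 6] <= [:: 2; 3; 4; 5; 6; 7]} by apply/allP.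
have ks7 : {subset [:: 2; 3; 7] <= [:: 2; 3; 4; 5; 6; 7]} by apply/allP.
have sT r G H : {subset [:: 2; 3; r] <= [:: 2; 3; 4; 5; 6; 7]} ->
    same [:: 2; 3; 4; 5; 6; 7] F G -> same [:: 2; 3; r] G H ->
    same [:: 2; 3; 4; 5; 6; 7] F H.
  by move=> sub s1 s2; apply: same_trans s1 (same_sub s2 sub).
have s0 : same [:: 2; 3; 4; 5; 6; 7] F F by [].
apply: runs_le.
- apply: runs_seq.
    apply: (@find_runs F _ _ (a i) (n + n) 4 (hlist m (a i))) => //.
    + exact: Et s0 _.
    + by move=> G s; apply: Ex (sT _ _ _ ks4 s0 s) _.
    + by move=> G s; apply: En (sT _ _ _ ks4 s0 s) _.
    + exact: ch s0.
  move=> M1 [G1 [-> s1 E4]]; have s1' := sT _ _ _ ks4 s0 s1.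
  apply: runs_seq.
    apply: (@find_runs G1 _ _ (b i) (G1 2 (G1 0 4).-1) 5 (hlist m (b i))) => //.
    + exact: Et s1' _.
    + by move=> G s; apply: Ey (sT _ _ _ ks5 s1' s) _.
    + by move=> G [sa sr]; rewrite eval_arr' // evE eval_reg' evE subn1 sa // sr.
    + exact: ch s1'.
  move=> M2 [G2 [-> s2 E5]]; have s2' := sT _ _ _ ks5 s1' s2.
  apply: runs_seq.
    apply: (@find_runs G2 _ _ (b i) (n + n) 6 (hlist m (b i))) => //.
    + exact: Et s2' _.
    + by move=> G s; apply: Ey (sT _ _ _ ks6 s2' s) _.
    + by move=> G s; apply: En (sT _ _ _ ks6 s2' s) _.
    + exact: ch s2'.
  move=> M3 [G3 [-> s3 E6]]; have s3' := sT _ _ _ ks6 s2' s3.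
  apply: runs_seq.
    apply: (@find_runs G3 _ _ (a i) (G3 2 (G3 0 6).-1) 7 (hlist m (a i))) => //.
    + exact: Et s3' _.
    + by move=> G s; apply: Ex (sT _ _ _ ks7 s3' s) _.
    + by move=> G [sa sr]; rewrite eval_arr' // evE eval_reg' evE subn1 sa // sr.
    + exact: ch s3'.
  move=> M4 [G4 [-> s4 E7]]; have s4' := sT _ _ _ ks7 s3' s4.
  apply: runs_straight => //.
  have [sa sr] := s4'.
  have e74 k : k \notin [:: 2; 3; 7] -> G4 0 k = G3 0 k by case: s4 => _; apply.
  have e63 k : k \notin [:: 2; 3; 6] -> G3 0 k = G2 0 k by case: s3 => _; apply.
  have e52 k : k \notin [:: 2; 3; 5] -> G2 0 k = G1 0 k by case: s2 => _; apply.
  apply: (decide_ok im (same_swap_ok s4' _ ok)) => //.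
  + by rewrite sa.
  + by rewrite sr.
  + by rewrite (pick_suiting_same _ _ s4') e74 // e63 // e52.
  + rewrite (pick_suiting_same _ _ s4') e74 // e63 // E5 (pick_suiting_same _ _ s1').
    by rewrite e74 // e63 // e52 // (proj1 s4' 2) // (proj1 s1' 2).
  + by rewrite (pick_suiting_same _ _ s4') e74 // E6 (pick_suiting_same _ _ s2').
  + rewrite (pick_suiting_same _ _ s4') E7 (pick_suiting_same _ _ s3').
    by rewrite e74 // (proj1 s4' 2) // (proj1 s3' 2).
- rewrite /centre_const.
  move: (wctime _) (wctime _) (wctime _) (wctime _) (wctime _) scan_time (cost _).
  by move=> *; lia.
Qed.

(** Scans are billed to [st0], the status before the swap phase, since an edge that still has status
    1 had it from the start. The total then refers to one fixed graph. *)
Lemma swap_body_runs st0 i F : i < m -> swap_ok st0 i F -> F 0 rI = i ->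
  runs swap_body (mem F)
    (swap_const + (st0 i != 0) *
       (2 * scan_time * (size (hlist m (a i)) + size (hlist m (b i)))))
    (fun M => exists F', [/\ M = mem F', swap_ok st0 i.+1 F' & F' 0 rI = i.+1]).
Proof.
move=> im ok F0i; set B := _ * (_ * _).
have [rm _ _ _ _ _] := swap_regs ok.
have skip : F 5 i != 1 -> forall c, runs Skip (mem F) c.+1
    (fun M => exists F', [/\ M = mem F', swap_ok st0 i.+1 F' & F' 0 rI = i]).
  move=> ne c; apply: runs_le; first apply: runs_straight => //.
    exists F; split=> //; have le2 := swap_le2 ok i; case: ok => *; split=> //.
    by apply: swap_skip => //; right.
  by [].
apply: runs_le.
- apply: (runs_seq
    (Q1 := fun M => exists F', [/\ M = mem F', swap_ok st0 i.+1 F' & F' 0 rI = i])).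
    apply: (runs_if (b := (cost (Defs.Sub (arr 5 (reg rI)) (Cst 1)) + (centre_const.+1 + B)).+1));
      rewrite !(eval_arr', eval_reg') // F0i => E1; last by apply: skip; rewrite E1.
    apply: runs_if; rewrite !(evE, eval_arr', eval_reg') // F0i => E2; first by apply: skip; lia.
    have Fi : F 5 i = 1 by lia.
    apply: runs_le; first exact: centre_runs im ok Fi F0i.
    by rewrite /B (swap_eq1 ok Fi) /= mul1n; lia.
  move=> M [F' [-> ok' F'i]]; apply: (runs_straight (p := next_i)) => //.
  rewrite /next_i run_rput' !(evE, eval_reg') F'i addn1.
  exists (updF F' 0 rI i.+1); split=> //; case: ok' => rF gF *; split=> //.
  - by case: rF.
  - by case: gF.
  - by apply: supp_updF => //; lia.
- rewrite /swap_const; move: (cost _) (cost _) centre_const (wctime _) B => *; lia.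
Qed.

(** Exchange of summation: instead of degrees in [D] at the ends of chosen edges, one adds, over all
    edges of [D], the degrees of the chosen graph at their two ends, each at most [t]. *)
Lemma scan_total st0 : (forall v, sdeg m a b st0 v <= t) ->
  \sum_(i < m) (st0 i != 0) * (size (hlist m (a i)) + size (hlist m (b i))) <=
  m * (t + t).
Proof.
move=> dt.
rewrite (eq_bigr (fun i : 'I_m => \sum_(j < m)
    ((st0 i != 0) * inc a b i (a j) + (st0 i != 0) * inc a b i (b j)))).
  rewrite exchange_big /= -[X in X * (t + t)]card_ord -sum_nat_const.
  by apply: leq_sum => j _; rewrite big_split; apply: leq_add; apply: dt.
move=> i _; rewrite !size_hlist -big_split big_distrr /=; apply: eq_bigr => j _.
by rewrite /inc -mulnDr !(eq_sym (a i)) !(eq_sym (b i)); congr (_ * _); lia.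
Qed.

Lemma swap_loop F : swap_ok (F 5) 0 F -> F 0 rI = 0 ->
  (forall v, sdeg m a b (F 5) v <= t) ->
  runs (While more_i swap_body) (mem F)
    (m * (cost more_i + swap_const).+1 + 2 * scan_time * (m * (t + t)) + (cost more_i).+1)
    (fun M => exists G, [/\ M = mem G, swap_ok (F 5) m G & G 0 rI = m]).
Proof.
move=> ok F0 dt; apply: runs_le.
  apply: (@runs_while _ _ m (fun i => swap_const + (F 5 i != 0) *
       (2 * scan_time * (size (hlist m (a i)) + size (hlist m (b i)))))
    (fun i M => exists G, [/\ M = mem G, swap_ok (F 5) i G & G 0 rI = i])).
  - by exists F.
  - move=> i M im [G [-> okG Gi]]; split; last exact: swap_body_runs.
    by rewrite evE !eval_reg' Gi (reg_m (swap_regs okG)) subn_eq0 -ltnNge.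
  - move=> M [G [-> okG Gi]].
    by rewrite evE !eval_reg' Gi (reg_m (swap_regs okG)) subnn.
rewrite leq_add2r.
rewrite (eq_bigr (fun i : 'I_m => (cost more_i + swap_const).+1 + 2 * scan_time *
   ((F 5 i != 0) * (size (hlist m (a i)) + size (hlist m (b i)))))); last first.
  move=> i _; move: (2 * scan_time) (cost _) swap_const (size _ + size _) (_ != _) => c1 c2 c3 c4 c5.
  by rewrite mulnCA; lia.
rewrite big_split /= sum_nat_const card_ord -big_distrr /= leq_add2l leq_mul2l.
by rewrite scan_total // orbT.
Qed.

Lemma load_swap_ok M F : load_inv m M F -> swap_ok (F 5) 0 (updF F 0 rI 0).
Proof.
move=> [_ _ rF gF grF dF sF]; split=> //.
- by case: rF.
- by case: gF.
- exact: swap_init.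
- by move=> j; apply: leq_trans (greedy_le1 grF j) _.
- by apply: supp_updF => //; lia.
Qed.

(** * Writing the chosen graph and calling [A] *)

Definition mk (F : arrays) (g : nat -> nat) : memory :=
  fun c => if c < Q then mem F c else g (c - Q).

Lemma mem_mk F : supp F -> mem F = mk F (fun=> 0).
Proof.
move=> sF; apply: functional_extensionality => c; rewrite /mk; case: ltnP => // Qc.
rewrite /mem ifN; last by lia.
have dv := divn_eq (c - R) 8; have md : (c - R) %% 8 < 8 by rewrite ltn_pmod.
by apply: sF; lia.
Qed.

Lemma eval_arr_mk F g f e : f < 8 -> eval (mk F g) e < L ->
  eval (mk F g) (arr f e) = F f (eval (mk F g) e).
Proof.
move=> f8 eL; set x := eval (mk F g) e in eL *.
have -> : eval (mk F g) (arr f e) = mk F g (R + (8 * x + f)).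
  rewrite /arr /addr eval_get !evE eval_get evE -/x.
  have -> : mk F g 1 = R by rewrite /mk ifT ?mem_base ?base1 //; lia.
  by congr (mk F g); lia.
by rewrite /mk ifT ?mem_cell //; lia.
Qed.

Lemma eval_reg_mk F g k : k < 16 -> eval (mk F g) (reg k) = F 0 k.
Proof. by move=> k16; rewrite eval_arr_mk // evE; lia. Qed.

Lemma run_rput_mk F g k x : k < 16 ->
  run (rput k x) (mk F g) = mk (updF F 0 k (eval (mk F g) x)) g.
Proof.
move=> k16; rewrite /rput /aput.
have -> : run (Put (addr 0 (Cst k)) x) (mk F g) =
    upd (mk F g) (R + (8 * k + 0)) (eval (mk F g) x).
  rewrite /run /addr !evE eval_get evE.
  have -> : mk F g 1 = R by rewrite /mk ifT ?mem_base ?base1 //; lia.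
  by congr upd; lia.
apply: functional_extensionality => c; move: (eval _ x) => v.
rewrite /mk -upd_mem ?R_gt1 // /upd; case: (c =P R + (8 * k + 0)) => [->|_] //.
by rewrite ifT //; lia.
Qed.

Lemma run_put_mk F g e x :
  run (Put e x) (mk F g) = upd (mk F g) (eval (mk F g) e) (eval (mk F g) x).
Proof. by []. Qed.

Lemma upd_mk F g c x : upd (mk F g) (Q + c) x = mk F (upd g c x).
Proof.
apply: functional_extensionality => d; rewrite /upd /mk.
case: ltnP => dQ; first by rewrite ifN //; lia.
by rewrite -[d in LHS](subnKC dQ) eqn_add2l subnKC.
Qed.

Lemma upd_mk_out p : p = Q ->
  forall F g c x, upd (mk F g) (p + c) x = mk F (upd g c x).
Proof. by move=> -> *; exact: upd_mk. Qed.

Lemma upd_mk_frame p : p = Q + (m + m + 1) ->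
  forall F g c x, upd (mk F g) (p + c) x = mk F (upd g (m + m + 1 + c) x).
Proof. by move=> -> *; rewrite -(addnA Q) upd_mk. Qed.

(** The first [2 m + 1] cells hold the output, the rest is the memory that [A] will see; the default
    0 of [nth] fills the remaining cells. *)
Definition out_mem l : nat -> nat := fun c =>
  if c < m + m + 1 then nth 0 (flat l) c else nth 0 (n :: flat l) (c - (m + m + 1)).

Lemma out_mem_rcons l e : size l < m ->
  upd (upd (upd (upd (upd (upd (out_mem l)
    (size l + size l + 1) e.1)
    (size l + size l + 2) e.2)
    (m + m + 1 + (size l + size l + 2)) e.1)
    (m + m + 1 + (size l + size l + 3)) e.2)
    0 (size l + 1))
    (m + m + 1 + 1) (size l + 1) = out_mem (rcons l e).
Proof.
move=> lm; apply: functional_extensionality => c; rewrite /out_mem.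
case: ltnP => hc.
  rewrite flat_rcons /upd; rewrite ifN; last by lia.
  case: eqP => // _; do 2!(rewrite ifN; last by lia).
  by case: eqP => // _; case: eqP => // _; rewrite hc.
rewrite -(subnKC hc); move: (c - _) => d; rewrite addKn.
case: d => [|d].
  by rewrite /upd !ifN ?addn0 ?ltnn ?subnn //; lia.
rewrite [RHS]flat_rcons /upd ltnNge leq_addr addKn /=.
by do !(case: eqP => ?; try lia).
Qed.

Definition picked (st : nat -> nat) i := [seq (a j, b j) | j <- iota 0 i & st j != 0].

Lemma pickedS st i : picked st i.+1 =
  if st i != 0 then rcons (picked st i) (a i, b i) else picked st i.
Proof.
rewrite /picked -addn1 iotaD filter_cat map_cat /= add0n.
by case: ifP => _ /=; rewrite ?cats1 ?cats0.
Qed.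

Lemma size_picked st i : size (picked st i) <= i.
Proof. by rewrite size_map size_filter; apply: leq_trans (count_size _ _) _; rewrite size_iota. Qed.

Definition out_inv (F : arrays) i (M : memory) := exists G,
  [/\ M = mk G (out_mem (picked (F 5) i)), same [:: rI; rCnt] F G,
      G 0 rI = i & G 0 rCnt = size (picked (F 5) i)].

Lemma out_step F i M : i < m -> regs_ok F -> graph_ok F m -> out_inv F i M ->
  out_inv F i.+1 (run out_body M).
Proof.
move=> im rF gF [G [-> sG Gi Gc]]; have [sa sr] := sG.
have iL : i < L by lia.
have Go : G 0 rOut = Q by rewrite sr //; case: rF.
have Gf : G 0 rFrame = Q + (m + m + 1) by rewrite sr //; case: rF.
have G1 : G 1 i = a i by rewrite sa //; case: gF => ->.
have G2 : G 2 i = b i by rewrite sa //; case: gF => _ ->.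
have eI G' g : G' 0 rI = i -> eval (mk G' g) (reg rI) = i by move=> E; rewrite eval_reg_mk.
have eA G' g f : f < 8 -> G' 0 rI = i -> eval (mk G' g) (arr f (reg rI)) = G' f i.
  by move=> f8 E; rewrite eval_arr_mk // eI.
rewrite /out_body run_seq run_ifE eA // sa // /out_inv pickedS.
case: ifP => Fi; last first.
  rewrite run_skip /next_i run_rput_mk // evE eI // evE addn1.
  by exists (updF G 0 rI i.+1); split=> //; apply: same_upd.
have sm : size (picked (F 5) i) < m by apply: leq_ltn_trans (size_picked _ _) im.
rewrite !run_seq.
do 4!(rewrite run_put_mk !evE !eval_reg_mk // eA // Gc ?G1 ?G2;
      rewrite ?(upd_mk_out Go) ?(upd_mk_frame Gf)).
rewrite run_rput_mk // !evE eval_reg_mk // Gc.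
set k := size _; set G' := updF _ _ _ _.
have Go' : G' 0 rOut = Q by exact: Go.
have Gf' : G' 0 rFrame = Q + (m + m + 1) by exact: Gf.
do 2!(rewrite run_put_mk !evE !eval_reg_mk //;
      rewrite ?(upd_mk_out Go') ?(upd_mk_frame Gf')).
rewrite /next_i run_rput_mk // !evE eval_reg_mk //.
exists (updF G' 0 rI i.+1); split.
- congr mk; first by rewrite addn1 (_ : G' 0 rI = i).
  by rewrite -out_mem_rcons // -!addnA.
- by apply: same_upd => //; apply: same_upd.
- by [].
- by rewrite /= size_rcons updFE /= /G' updFE /= addn1.
Qed.

Lemma out_loop F M : regs_ok F -> graph_ok F m -> out_inv F 0 M ->
  runs (While more_i out_body) M
    (m * (cost more_i + wctime out_body).+1 + (cost more_i).+1) (out_inv F m).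
Proof.
move=> rF gF H0; rewrite -[X in X * _](card_ord m) -sum_nat_const.
apply: (@runs_while _ _ m (fun=> wctime out_body) (out_inv F)) => //.
- move=> i M' im [G [E sG Gi Gc]]; split; last first.
    by apply: runs_straight => //; apply: out_step => //; exists G.
  rewrite E evE !eval_reg_mk // Gi (proj2 sG) // (reg_m rF).
  by rewrite subn_eq0 -ltnNge.
- move=> M' [G [-> sG Gi _]].
  by rewrite evE !eval_reg_mk // Gi (proj2 sG) // (reg_m rF) subnn.
Qed.

Lemma finish_runs F A M TA mA : regs_ok F -> out_inv F m M ->
  exec A (nth 0 (n :: flat (picked (F 5) m))) TA mA ->
  exists T M', [/\ exec (finish A) M T M',
    T <= finish_time + TA,
    stored M' (M' 0) (flat (picked (F 5) m)) &
    forall s, stored mA (mA 0) s -> stored M' (M' 1) s].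
Proof.
move=> rF [G [{M}-> [sa sr] _ _]]; set l := picked (F 5) m => eA.
have Go : G 0 rOut = Q by rewrite sr //; case: rF.
have Gf : G 0 rFrame = Q + (m + m + 1) by rewrite sr //; case: rF.
set M := mk G (out_mem l).
have [B BE] : exists B, B = Q + (m + m + 1) by eexists.
rewrite -BE in Gf.
have frE : frame B M = nth 0 (n :: flat l).
  apply: functional_extensionality => c; rewrite /frame /M /mk ifN; last by lia.
  by rewrite /out_mem ifN; [congr nth|]; lia.
have lm : size l <= m by apply: size_picked.
pose M1 := unframe B M mA.
have M1lt c : c < B -> M1 c = M c by rewrite /M1 /unframe => ->.
have M1ge c : M1 (B + c) = mA c by rewrite /M1 /unframe ifN ?addKn //; lia.
have e1 : exec (Call (reg rFrame) A) M (cost (reg rFrame) + TA).+1 M1.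
  rewrite /M1 -Gf -(eval_reg_mk G (out_mem l) (k := rFrame)) //.
  by apply: exec_call; rewrite eval_reg_mk // Gf frE.
have M11 : M1 1 = R.
  by rewrite M1lt; [rewrite /M /mk ifT ?mem_base ?base1 //; lia | lia].
(* Registers stay readable after the call and after the change of cell 0, since the arrays lie below
   the frame and cell 1 still holds [R]. *)
have evr k (M' : memory) : k < 16 -> M' 1 = R -> (forall c, 1 < c < B -> M' c = M c) ->
    eval M' (reg k) = G 0 k.
  move=> k16 E1 E; rewrite /reg /arr /addr eval_get !evE eval_get evE E1.
  rewrite E; last by lia.
  rewrite /M /mk ifT; last by lia.
  by rewrite -(mem_cell R base G k (isT : 0 < 8)); congr (mem G); lia.
pose M2 := upd M1 0 Q; pose M3 := upd M2 1 (B + mA 0).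
have e2 : exec (Put (Cst 0) (reg rOut)) M1 (1 + cost (reg rOut)).+1 M2.
  have -> : M2 = upd M1 (eval M1 (Cst 0)) (eval M1 (reg rOut)); last exact: exec_set.
  by rewrite evE (evr rOut) ?Go // => c /andP[_]; exact: M1lt.
have e3 : exec (Put (Cst 1) (Add (reg rFrame) (Get (reg rFrame)))) M2
    (1 + cost (Add (reg rFrame) (Get (reg rFrame)))).+1 M3.
  have evf : eval M2 (reg rFrame) = B.
    by rewrite (evr rFrame) ?Gf // => c /andP[c1 cB]; rewrite /M2 /upd ifN ?M1lt //; lia.
  have -> : M3 = upd M2 (eval M2 (Cst 1)) (eval M2 (Add (reg rFrame) (Get (reg rFrame)))).
    rewrite !evE eval_get evf /M3; congr (upd _ _ (_ + _)).
    by rewrite /M2 /upd ifN; [rewrite -[X in M1 X]addn0 M1ge | lia].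
  exact: exec_set.
exists ((cost (reg rFrame) + TA).+1 + ((1 + cost (reg rOut)).+1 +
  (1 + cost (Add (reg rFrame) (Get (reg rFrame)))).+1)), M3; split.
- exact: exec_seq e1 (exec_seq e2 e3).
- by rewrite /finish_time; move: (cost _) (cost _) (cost _) => *; lia.
- have -> : M3 0 = Q by [].
  move=> j; rewrite size_flat => jl.
  rewrite /M3 /M2 /upd !ifN; try lia.
  rewrite M1lt; last by lia.
  by rewrite /M /mk ifN ?addKn /out_mem ?ifT //; lia.
- have -> : M3 1 = B + mA 0 by [].
  move=> s Hs j js; rewrite -Hs // -(M1ge (mA 0 + j)) addnA /M3 /M2 /upd !ifN //; lia.
Qed.

Lemma out_init_inv st0 F : swap_ok st0 m F -> out_inv F 0 (run out_init (mem F)).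
Proof.
move=> ok; have Gf : updF F 0 rI 0 0 rFrame = Q + (m + m + 1) by case: (swap_regs ok).
rewrite /out_init run_seq run_rput' evE mem_mk; last first.
  by apply: supp_updF; [exact: swap_supp ok | lia].
rewrite run_put_mk !evE eval_reg_mk // eval_get evE (upd_mk_frame Gf).
have -> : mk (updF F 0 rI 0) (fun=> 0) 0 = n.
  by rewrite /mk ifT ?mem_base ?base0 //; lia.
exists (updF F 0 rI 0); split=> //; last by case: (swap_regs ok).
- congr mk; apply: functional_extensionality => c; rewrite /upd /out_mem /=.
  case: eqP => [->|ne]; first by rewrite ifN ?addn0 ?subnn //; lia.
  case: ltnP => hc; first by case: (c) => [|[]].
  rewrite -(subnKC hc); have : c - (m + m + 1) != 0 by lia.
  by rewrite addKn; move: (c - _) => [|[|[]]].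
- by apply: same_upd.
Qed.

Lemma main_runs M F : load_inv 0 M F ->
  runs main M (main_const * (m + m * t + 1))
    (fun M' => exists st0 F', swap_ok st0 m F' /\ out_inv F' m M').
Proof.
move=> H0; apply: runs_le.
- apply: runs_seq; first exact: load_loop H0.
  move=> M1 [F1 H1]; have ok1 := load_swap_ok H1.
  apply: (runs_seq (Q1 := fun M' => M' = mem (updF F1 0 rI 0))).
    by apply: runs_straight => //; case: H1 => -> *; rewrite run_rput' evE.
  move=> _ ->; apply: runs_seq.
    by apply: swap_loop => //; case: (load_greedy H1).
  move=> _ [F2 [-> ok2 _]].
  apply: runs_seq.
    by apply: runs_straight => //; exact: out_init_inv ok2.
  move=> M3 H3; apply: runs_post; first exact: out_loop (swap_regs ok2) (swap_graph ok2) H3.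
  by move=> M4 H4; exists (F1 5), F2.
- rewrite /main_const; move: (cost _) (wctime _) swap_const scan_time (wctime _) (wctime _) (wctime _) => *; nia.
Qed.

End Run.

(** * The initial memory *)

Lemma setup_ok n m t (base0 : memory) a b :
  base0 0 = n -> base0 1 = m -> (forall c, m + m + 2 <= c -> base0 c = 0) ->
  let R := m + m + 2 in
  exists F, load_inv n m t a b (upd base0 1 R) 0 (run (setup t) base0) F.
Proof.
move=> E0 E1 Ez R.
have R1 : 1 < R by rewrite /R addn2.
have B1 : upd base0 1 R 1 = R by rewrite upd_same.
pose F0 : arrays := updF (fun _ _ => 0) 0 rM m.
have S1 : run (Put (Cst 1) (Add (dbl (Get (Cst 1))) (Cst 2)))
   (run (Put (Add (dbl (Get (Cst 1))) (Cst 2)) (Get (Cst 1))) base0) = mem R (upd base0 1 R) F0.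
  rewrite /run !evE !eval_get !evE.
  have -> : base0 1 + base0 1 + 2 = R by rewrite E1.
  have -> : upd base0 R (base0 1) 1 = m by rewrite /upd ifN ?E1 //; lia.
  rewrite E1 -/R; apply: functional_extensionality => c; rewrite /mem /upd.
  case: (c =P 1) => [->|c1]; first by rewrite R1.
  case: (c =P R) => [->|cR]; first by rewrite ltnn subnn /F0 updFE.
  case: ltnP => // Rc; rewrite Ez //; rewrite /F0 updFE; case: andP => // -[/eqP h1 /eqP h2].
  by have := divn_eq (c - R) 8; lia.
rewrite /setup !evE S1.
do 4!(rewrite (run_rput R1 B1) ?(eval_get _ (Cst _)) ?evE ?(eval_reg R1 B1) ?updFE /=).
have m0 G : mem R (upd base0 1 R) G 0 = n by rewrite /mem /upd /= E0 ifT; lia.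
have m1 G : mem R (upd base0 1 R) G 1 = R by rewrite /mem R1.
set F := updF _ _ _ _; exists F; split=> //.
- by split=> //; rewrite /F ?updFE /= ?m0 ?m1 ?evE // /F0 updFE /R /=; lia.
- exact: greedy_init.
- by move=> v; rewrite /sdeg big1.
- by rewrite /F; do 5!(apply: supp_updF; last lia).
Qed.

(** * From vertex codes back to multigraphs *)

Section Assembly.

Variables (n : nat) (D : mgraph n).

Let m := size D.
Let code (e : vertex n * vertex n) := (vcode e.1, vcode e.2).
Let cd j := nth (0, 0) (map code D) j.
Let a j := (cd j).1.
Let b j := (cd j).2.

Lemma cd_tnth (i : 'I_m) : cd i = code (tnth (in_tuple D) i).
Proof.
rewrite /cd (tnth_nth (tnth (in_tuple D) i)) /=.
by rewrite (nth_map (tnth (in_tuple D) i)).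
Qed.

Lemma flat_map_code D' : flat (map code D') = enc_mgraph D'.
Proof. by rewrite /flat /enc_mgraph size_map -map_comp. Qed.

Lemma inc_vcode (i : 'I_m) v :
  inc a b i (vcode v) = (end1 i == v) + (end2 i == v).
Proof. by rewrite /inc /a /b cd_tnth /= !(inj_eq (@vcode_inj n)). Qed.

Definition kept (st : nat -> nat) : mgraph n := mask [seq st j != 0 | j <- iota 0 m] D.

Lemma kept_picked st : picked a b st m = map code (kept st).
Proof.
rewrite /picked /kept map_mask filter_mask.
rewrite map_mask; congr mask; rewrite -[RHS](mkseq_nth (0, 0)) size_map.
by apply: eq_map => j; rewrite /a /b /cd; case: nth.
Qed.

Lemma kept_set st :
  [set i : 'I_m | nth false [seq st j != 0 | j <- iota 0 m] i] = [set i : 'I_m | st i != 0].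
Proof.
by apply/setP => i; rewrite !inE (nth_map 0) ?size_iota // nth_iota.
Qed.

Lemma sdeg_vcode st v :
  sdeg m a b st (vcode v) = idx_deg (@end1 n D) (@end2 n D) [set i : 'I_m | st i != 0] v.
Proof.
rewrite /sdeg /idx_deg [RHS]big_mkcond /=; apply: eq_bigr => i _.
by rewrite inE inc_vcode; case: (st i != 0); rewrite ?mul1n ?mul0n.
Qed.

Lemma deg_kept st v : deg (kept st) v = sdeg m a b st (vcode v).
Proof. by rewrite /kept mask_idx_deg kept_set sdeg_vcode. Qed.

Lemma kept_ratio st t Dopt : loopless D -> t <= n -> swap_inv m t a b st m ->
  submgraph Dopt D -> realizable Dopt -> 2 * t * size Dopt <= 3 * n * size (kept st).
Proof.
move=> lD tn [dt mx dn] sub rz.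
have [bs <- degE] := submgraph_mask sub.
rewrite !mask_card kept_set.
have joinE (i : 'I_m) x z : links (@end1 n D) (@end2 n D) i x z =
    joinn a b i (vcode x) (vcode z).
  by rewrite /links /joinn /a /b cd_tnth /= !(inj_eq (@vcode_inj n)).
have aE (i : 'I_m) : a i = vcode (end1 i) by rewrite /a cd_tnth.
have bE (i : 'I_m) : b i = vcode (end2 i) by rewrite /b cd_tnth.
apply: (swap_free_ratio (a := @end1 n D) (b := @end2 n D)) => //.
- by move=> i; move/allP: lD; apply; apply: mem_tnth.
- by move=> v; rewrite -sdeg_vcode.
- move=> v; rewrite -mask_idx_deg degE; apply: realizable_deg => //.
  exact: loopless_sub sub lD.
- move=> j; rewrite inE negbK => /eqP sj; rewrite -!sdeg_vcode -aE -bE.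
  exact: mx (ltn_ord j) sj.
- move=> i j k u w; rewrite !inE !negbK => si sj sk lj lk; rewrite -!sdeg_vcode => ut wt.
  (* Distinct far ends are always compatible, so [i], [j], [k] would form a swap. *)
  apply/eqP/negPn/negP => ne; have [] := dn i (ltn_ord i).
    by right; split; [exact/eqP | exact: ltn_ord].
  exists j, k, (vcode u), (vcode w); rewrite /avail /compat.
  rewrite !ltn_ord sj sk ut wt aE bE -!joinE lj lk !(inj_eq (@vcode_inj n)) ne.
  by [].
Qed.

Lemma kept_maxdeg st t : (forall v, sdeg m a b st v <= t) -> maxdeg (kept st) <= t.
Proof. by move=> dt; apply/bigmax_leqP => v _; rewrite deg_kept. Qed.

Lemma loopless_kept st : loopless D -> loopless (kept st).
Proof. exact: loopless_sub (submgraph_of_mask _ _). Qed.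

Lemma instance_edge j : j < m ->
  instance D (j + j + 2) = a j /\ instance D (j + j + 3) = b j.
Proof.
rewrite /instance /enc_mgraph /a /b /cd /m => jm.
rewrite !addnS addn0 /=.
elim: D j jm => //= e D' IH [|j] // jm; rewrite addSn addnS /=; exact: IH.
Qed.

Lemma run_algorithm t A : computes_realizations A t n -> loopless D ->
  exists st T M TA mA P,
  [/\ exec (setup t ;; main ;; finish A) (instance D) T M,
      outputs_realized M (kept st) P /\ realization (kept st) P,
      swap_inv m t a b st m,
      exec A (instance (kept st)) TA mA &
      T <= wctime (setup 0) + main_const * (m + m * t + 1) + finish_time + TA].
Proof.
move=> cA lD.
have a_lt j : j < m -> a j < n + n.
  by move=> jm; rewrite /a -[j]/(val (Ordinal jm)) cd_tnth /= vcode_lt.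
have b_lt j : j < m -> b j < n + n.
  by move=> jm; rewrite /b -[j]/(val (Ordinal jm)) cd_tnth /= vcode_lt.
have ab j : j < m -> a j != b j.
  move=> jm; rewrite /a /b -[j]/(val (Ordinal jm)) cd_tnth /= (inj_eq (@vcode_inj n)).
  by move/allP: lD; apply; apply: mem_tnth.
set base := upd (instance D) 1 (m + m + 2).
have base0 : base 0 = n by [].
have base1 : base 1 = m + m + 2 by [].
have basea j : j < m -> base (j + j + 2) = a j.
  by move=> jm; rewrite /base /upd ifN ?(proj1 (instance_edge jm)) //; lia.
have baseb j : j < m -> base (j + j + 3) = b j.
  by move=> jm; rewrite /base /upd ifN ?(proj2 (instance_edge jm)) //; lia.
have inst0 c : m + m + 2 <= c -> instance D c = 0.
  move=> hc; rewrite /instance nth_default // -flat_map_code.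
  rewrite -[size _]/((size (flat (map code D))).+1) size_flat size_map.
  by rewrite -/m; lia.
have [F0 H0] := @setup_ok n m t (instance D) a b erefl erefl inst0.
have rS : runs (setup t) (instance D) (wctime (setup t)) (fun M => M = run (setup t) (instance D)).
  exact: runs_straight.
have [T1 [M1 [e1 b1 E1]]] := rS; rewrite -E1 in H0.
have [T2 [M2 [e2 b2 [st0 [F [ok oi]]]]]] := main_runs a_lt b_lt ab base0 base1 basea baseb H0.
have [dt _ _] := swap_invF ok.
have [TA [mA [P [eA sA rP]]]] := cA _ (loopless_kept (F 5) lD) (kept_maxdeg dt).
have eA' : exec A (nth 0 (n :: flat (picked a b (F 5) m))) TA mA.
  by rewrite kept_picked flat_map_code.
have [T3 [M3 [e3 b3 s0 s1]]] := finish_runs base0 base1 (swap_regs ok) oi eA'.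
exists (F 5), (T1 + (T2 + T3)), M3, TA, mA, P; split=> //.
- exact: exec_seq e1 (exec_seq e2 e3).
- split=> //; split; last exact: s1.
  by rewrite kept_picked flat_map_code in s0.
- exact: swap_invF ok.
(* A literal costs 1 whatever its value, so the bound on the setup is free of [t]. *)
- have -> : wctime (setup 0) = wctime (setup t) by [].
  by move: (wctime _) main_const finish_time b1 b2 b3 => *; lia.
Qed.

End Assembly.

Lemma mgraph_nil n (D : mgraph n) : n = 0 -> D = [::].
Proof.
move=> n0; case: D => // -[[c i] v] D'.
by have := leq_trans (ltn_ord i) (eq_leq n0).
Qed.

Theorem theorem9 :
  exists C : nat, forall (t : nat) (A : prog), 0 < t ->
  exists B : prog, forall n : nat, computes_realizations A t n ->
  forall D : mgraph n, loopless D ->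
  exists (Dstar : mgraph n) (P : seq (seq (vertex n))) (TB : nat) (mB : memory),
    [/\ exec B (instance D) TB mB,
        outputs_realized mB Dstar P,
        submgraph Dstar D /\ realization Dstar P,
        (forall Dopt : mgraph n, max_realizable D Dopt ->
           (((2 * t)%:R / (3 * n)%:R) * (size Dopt)%:R
              <= (size Dstar)%:R :> rat)%R) &
        exists (TA : nat) (mA : memory),
          exec A (instance Dstar) TA mA /\
          TB <= C * (size D * n + 1) + TA].
Proof.
exists (wctime (setup 0) + 3 * main_const + finish_time) => t A t0.
exists (setup t ;; main ;; finish A) => n cA D lD.
have [st [T [M [TA [mA [P [eB [oR rP] inv eA le]]]]]]] := run_algorithm cA lD.
exists (kept D st), P, T, M; split=> //.
- by split=> //; apply: submgraph_of_mask.
- move=> Dopt [sub rz _]; case: (posnP n) => [n0|n0].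
    (* For [n = 0] the inverse of the denominator is 0 by convention, so the claim reads
       [0 <= e(Dstar)]. *)
    rewrite [X in (X%:R)^-1%R](_ : _ = 0); last by rewrite n0 muln0.
    by rewrite GRing.invr0 GRing.mulr0 GRing.mul0r Num.Theory.ler0n.
  have H := kept_ratio lD (computes_le n0 cA) inv sub rz.
  rewrite GRing.mulrAC Num.Theory.ler_pdivrMr ?Num.Theory.ltr0n ?muln_gt0 //.
  by rewrite -!GRing.natrM Num.Theory.ler_nat [leqRHS]mulnC.
- exists TA, mA; split=> //; apply: leq_trans le _; rewrite leq_add2r.
  (* With [m = size D], these bounds give [m + m t + 1 <= 3 (m n + 1)], the source of the factor 3
     in the constant. For [n = 0] there are no edges. *)
  have [mn mt] : size D <= size D * n /\ size D * t <= size D * n.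
    case: (posnP n) => [n0|n0]; last first.
      by rewrite leq_pmulr // leq_mul2l (computes_le n0 cA) orbT.
    by rewrite (mgraph_nil D n0).
  move: (wctime _) main_const finish_time => *; nia.
Qed.
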